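(* Let $(X,d)$ be a metric space, $\phi:X\to(-\infty,+\infty]$ a proper lower semicontinuous functional, $\lambda\in\mathbb R$, and suppose that $\phi$ admits an $\mathrm{EVI}_\lambda$-gradient flow $(\mathsf S_t)_{t\ge0}$ in the subset $D\subset\overline{\mathrm{Dom}(\phi)}$. Then the following hold: (1) if $x_0,x_1\in D\cap\mathrm{Dom}(\phi)$, $\vartheta,\varepsilon\in(0,1)$ and $x_{\vartheta,\varepsilon}\in D$ is a $(\vartheta,\varepsilon)$-intermediate point between them, then $$\phi(\mathsf S_t(x_{\vartheta,\varepsilon}))\le(1-\vartheta)\phi(x_0)+\vartheta\phi(x_1)-\frac12\Big(\lambda-\frac{\varepsilon^2}{\mathsf E_\lambda(t)}\Big)\vartheta(1-\vartheta)d^2(x_0,x_1)\quad\text{for every }t>0;$$ (2) if $D$ is an approximate length subset then $\phi$ is approximately $\lambda$-convex in $D$; (3) if $D=X=\overline{\mathrm{Dom}(\phi)}^{d_\ell}$ (closure with respect to the length distance $d_\ell$), then $\phi$ is approximately $\lambda$-convex with respect to the distance $d_\ell$ on each equivalence class of $\sim_\ell$; (4) if $x_0,x_1\in D\cap\mathrm{Dom}(\phi)$ and $\mathsf x\in\mathrm{Geo}_D[x_0\to x_1]$, then $$\phi(\mathsf x_t)\le(1-t)\phi(x_0)+t\phi(x_1)-\frac\lambda2t(1-t)d^2(x_0,x_1)\quad\text{for every }t\in[0,1];$$ in particular, if for every $x_0,x_1\in D\cap\mathrm{Dom}(\phi)$ the set $\mathrm{Geo}_D[x_0\to x_1]$ is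 not empty, then $\phi$ is strongly $\lambda$-convex in $D$.
   Context: $\mathrm{Dom}(\phi):=\{x\in X:\phi(x)<+\infty\}$. $\mathsf E_\lambda(t):=\int_0^te^{\lambda r}\,\mathrm dr$. $\frac{\mathrm d}{\mathrm dt}^{+}\zeta(t):=\limsup_{h\downarrow0}\frac{\zeta(t+h)-\zeta(t)}h$. A solution of $\mathrm{EVI}_\lambda(X,d,\phi)$ is a continuous curve $u:(0,+\infty)\to\mathrm{Dom}(\phi)$ with $\frac12\frac{\mathrm d}{\mathrm dt}^{+}d^2(u_t,v)+\frac\lambda2d^2(u_t,v)\le\phi(v)-\phi(u_t)$ for every $t>0$, $v\in\mathrm{Dom}(\phi)$. An $\mathrm{EVI}_\lambda$-gradient flow of $\phi$ in $D$ is a family of continuous maps $\mathsf S_t:D\to D$, $t\ge0$, such that for every $u_0\in D$: $\mathsf S_{t+h}(u_0)=\mathsf S_h(\mathsf S_t(u_0))$ for all $t,h\ge0$, $\lim_{t\downarrow0}\mathsf S_t(u_0)=\mathsf S_0(u_0)=u_0$, and $t\mapsto\mathsf S_t(u_0)$ is a solution of $\mathrm{EVI}_\lambda(X,d,\phi)$. For $\vartheta,\varepsilon\in(0,1)$, $x$ is a $(\vartheta,\varepsilon)$-intermediate point between $x_0,x_1$ if $\frac{d^2(x_0,x)}\vartheta+\frac{d^2(x,x_1)}{1-\vartheta}\le d^2(x_0,x_1)(1+\varepsilon^2\vartheta(1-\vartheta))$; it is an $\varepsilon$-midpoint if $\vartheta=1/2$. $D$ is an approximate length subset if for every $x_0,x_1\in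 D$ and $\varepsilon\in(0,1)$ there is an $\varepsilon$-midpoint $x\in D$ between $x_0$ and $x_1$. $\phi$ is approximately $\lambda$-convex in $D$ if for every $x_0,x_1\in D\cap\mathrm{Dom}(\phi)$ and $\vartheta,\varepsilon\in(0,1)$ there is a $(\vartheta,\varepsilon)$-intermediate point $x_{\vartheta,\varepsilon}\in D$ between $x_0$ and $x_1$ with $\phi(x_{\vartheta,\varepsilon})\le(1-\vartheta)\phi(x_0)+\vartheta\phi(x_1)-\frac{\lambda-\varepsilon}2\vartheta(1-\vartheta)d^2(x_0,x_1)$. In (3) the same definition is used with $d$ replaced by $d_\ell$ and $D$ by an equivalence class. $\mathrm{Geo}_D[x_0\to x_1]$ is the set of curves $\mathsf x:[0,1]\to D$ with $\mathsf x_0=x_0$, $\mathsf x_1=x_1$ and $d(\mathsf x_s,\mathsf x_t)=|s-t|\,d(x_0,x_1)$ for all $s,t\in[0,1]$. $\phi$ is strongly $\lambda$-convex in $D$ if for every $x_0,x_1\in D\cap\mathrm{Dom}(\phi)$ the set $\mathrm{Geo}_D[x_0\to x_1]$ is nonempty and the inequality displayed in (4) holds along every $\mathsf x\in\mathrm{Geo}_D[x_0\to x_1]$. Length distance: a curve $\mathsf x:[0,1]\to X$ is absolutely continuous if there is $m\in L^1(0,1)$ with $d(\mathsf x_s,\mathsf x_t)\le\int_s^tm(r)\,\mathrm dr$ for $s\le t$; its length is $\int_0^1|\dot{\mathsf x}|(t)\,\mathrm dt$, with $|\dot{\mathsf x}|(t)=\lim_{h\to0}d(\mathsf x_{t+h},\mathsf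 x_t)/|h|$ (existing a.e.). $d_\ell(x_0,x_1)\in[0,+\infty]$ is the infimum of the lengths of absolutely continuous curves in $X$ from $x_0$ to $x_1$ ($+\infty$ if none). $x\sim_\ell y$ means $d_\ell(x,y)<+\infty$. *)

(* Defs.v *)
From mathcomp Require Import all_boot all_order all_algebra.
From mathcomp Require Import all_classical all_reals all_analysis.

Set Implicit Arguments.
Unset Strict Implicit.
Unset Printing Implicit Defensive.

Import Order.TTheory GRing.Theory Num.Theory.
Import numFieldNormedType.Exports.

Local Open Scope classical_set_scope.
Local Open Scope ring_scope.

(* Curves on an interval are functions [R -> X] that are only ever constrained
   and evaluated on that interval. *)

Definition Dom (R : realType) (X : Type) (phi : X -> \bar R) : set X :=
  [set x | (phi x < +oo)%E].

Definition Elambda (R : realType) (lambda t : R) : R :=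
  \int[lebesgue_measure]_(r in `[0, t]) expR (lambda * r).

(* The upper right Dini derivative, which may be infinite. *)
Definition right_dini (R : realType) (zeta : R -> R) (t : R) : \bar R :=
  limf_esup (fun h : R => ((zeta (t + h) - zeta t) / h)%:E) 0^'+.

Record EVI_solution (R : realType) (X : metricType R) (phi : X -> \bar R)
    (lambda : R) (u : R -> X) : Prop := {
  EVI_continuous : {within `]0, +oo[, continuous u};
  EVI_dom : forall t : R, 0 < t -> Dom phi (u t);
  EVI_ineq : forall t : R, 0 < t -> forall v, Dom phi v ->
    ((2^-1)%:E * right_dini (fun s : R => mdist (u s) v ^+ 2)%R t
     + (lambda / 2 * mdist (u t) v ^+ 2)%:E <= phi v - phi (u t))%E }.

Record EVI_flow (R : realType) (X : metricType R) (phi : X -> \bar R)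
    (lambda : R) (D : set X) (S : R -> X -> X) : Prop := {
  EVI_flow_stable : forall t : R, 0 <= t -> forall x, D x -> D (S t x);
  EVI_flow_continuous : forall t : R, 0 <= t -> {within D, continuous (S t)};
  EVI_flow_semigroup : forall u0, D u0 -> forall t h : R, 0 <= t -> 0 <= h ->
    S (t + h) u0 = S h (S t u0);
  EVI_flow_init : forall u0, D u0 -> S 0 u0 = u0;
  EVI_flow_lim : forall u0, D u0 -> S t u0 @[t --> 0^'+] --> u0;
  EVI_flow_solution : forall u0, D u0 ->
    EVI_solution phi lambda (fun t => S t u0) }.

(* The notions below take the distance as a parameter, since they are used both
   for [mdist] and for the length distance. *)

Definition intermediate (R : realType) (X : Type) (dist : X -> X -> R)
    (theta eps : R) (x0 x1 x : X) : Prop :=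
  dist x0 x ^+ 2 / theta + dist x x1 ^+ 2 / (1 - theta)
  <= dist x0 x1 ^+ 2 * (1 + eps ^+ 2 * theta * (1 - theta)).

Definition midpoint (R : realType) (X : Type) (dist : X -> X -> R)
    (eps : R) (x0 x1 x : X) : Prop :=
  intermediate dist 2^-1 eps x0 x1 x.

Definition approx_length_subset (R : realType) (X : Type)
    (dist : X -> X -> R) (D : set X) : Prop :=
  forall x0 x1, D x0 -> D x1 -> forall eps : R, 0 < eps < 1 ->
    exists2 x, D x & midpoint dist eps x0 x1 x.

Definition approx_convex (R : realType) (X : Type) (dist : X -> X -> R)
    (phi : X -> \bar R) (lambda : R) (D : set X) : Prop :=
  forall x0 x1, (D `&` Dom phi) x0 -> (D `&` Dom phi) x1 ->
  forall theta eps : R, 0 < theta < 1 -> 0 < eps < 1 ->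
  exists x, [/\ D x, intermediate dist theta eps x0 x1 x &
    (phi x <= (1 - theta)%:E * phi x0 + theta%:E * phi x1
      - ((lambda - eps) / 2 * theta * (1 - theta) * dist x0 x1 ^+ 2)%:E)%E].

Definition Geo (R : realType) (X : metricType R) (D : set X) (x0 x1 : X) :
    set (R -> X) :=
  [set x | [/\ (forall t : R, 0 <= t <= 1 -> D (x t)), x 0 = x0, x 1 = x1 &
    forall s t : R, 0 <= s <= 1 -> 0 <= t <= 1 ->
      mdist (x s) (x t) = `|s - t| * mdist x0 x1]].

Definition convex_along (R : realType) (X : metricType R)
    (phi : X -> \bar R) (lambda : R) (x0 x1 : X) (x : R -> X) : Prop :=
  forall t : R, 0 <= t <= 1 ->
    (phi (x t) <= (1 - t)%:E * phi x0 + t%:E * phi x1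
      - (lambda / 2 * t * (1 - t) * mdist x0 x1 ^+ 2)%:E)%E.

Definition strongly_convex (R : realType) (X : metricType R)
    (phi : X -> \bar R) (lambda : R) (D : set X) : Prop :=
  forall x0 x1, (D `&` Dom phi) x0 -> (D `&` Dom phi) x1 ->
    Geo D x0 x1 !=set0 /\
    forall x, Geo D x0 x1 x -> convex_along phi lambda x0 x1 x.

Definition abs_cont_curve (R : realType) (X : metricType R) (x : R -> X) :
    Prop :=
  exists2 m : R -> R,
    lebesgue_measure.-integrable `]0, 1[ (EFin \o m) &
    forall s t : R, 0 <= s -> s <= t -> t <= 1 ->
      mdist (x s) (x t) <= \int[lebesgue_measure]_(r in `]s, t[) m r.

(* [lim] is an arbitrary constant at the points where the limit does not exist;
   for an absolutely continuous curve these are negligible in ]0, 1[. *)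
Definition metric_derivative (R : realType) (X : metricType R) (x : R -> X)
    (t : R) : R :=
  lim (mdist (x (t + h)) (x t) / `|h| @[h --> 0^']).

Definition curve_length (R : realType) (X : metricType R) (x : R -> X) :
    \bar R :=
  (\int[lebesgue_measure]_(t in `]0%R, 1%R[) (metric_derivative x t)%:E)%E.

(* The infimum of the empty set is +oo. *)
Definition length_dist (R : realType) (X : metricType R) (x0 x1 : X) :
    \bar R :=
  ereal_inf [set curve_length x | x in
    [set x : R -> X | [/\ abs_cont_curve x, x 0 = x0 & x 1 = x1]]].

Definition length_class (R : realType) (X : metricType R) (z : X) : set X :=
  [set x | (length_dist z x < +oo)%E].

Definition length_closure (R : realType) (X : metricType R) (A : set X) :
    set X :=
  [set x | forall e : R, 0 < e -> exists2 y, A y & (length_dist x y < e%:E)%E].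

(* [fine] is harmless inside one equivalence class, where the length distance
   is finite. *)
Definition length_dist_fin (R : realType) (X : metricType R) (x0 x1 : X) : R :=
  fine (length_dist x0 x1).

(* Main.v *)
(** Integrating EVI against a test point [v] in [Dom phi] gives
    [e^(lambda t)/2 d^2(S_t x, v) - 1/2 d^2(x, v) <= E_lambda(t) (phi v - phi (S_t x))].
    Taking a convex combination of this inequality for [v = x0] and [v = x1],
    with [x] an intermediate point of [x0, x1], the elementary bound
    [(1-theta) a^2 + theta b^2 >= theta (1-theta) (a + b)^2] yields (1); letting
    the accuracy of [x], then [t], tend to 0 gives (4) by lower semicontinuity.
    For (2), almost midpoints are first iterated to reach every [theta], and
    [S_t x] is the required point: the lower bound of [phi] along the flow, itself
    a consequence of EVI, shows that it remains an intermediate point for small [t].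

    For (3) the same scheme runs with the length distance, once EVI is known for it up
    to terms of order [t^2].  This is obtained by letting the flow act on a curve
    [g] joining [v] to [x] with a running time growing linearly from 0 to [t]:
    contraction and EVI bound the energy of [s |-> S_s (g (c s / t))].  Length-distance
    bounds are translated into 1-Lipschitz paths; the nontrivial direction needs the
    almost everywhere existence of the metric derivative of an absolutely continuous
    curve [x], which follows from Lebesgue differentiation of the functions
    [t |-> d(x_q, x_t)], [q] rational, whose densities come from Radon-Nikodym. *)
From HB Require Import structures.
Require Import Defs.
From mathcomp Require Import all_boot all_order all_algebra.
From mathcomp Require Import all_classical all_reals all_analysis.
From mathcomp Require Import measurable_realfun ring lra.

Import Order.TTheory GRing.Theory Num.Theory.
Import numFieldNormedType.Exports.

Local Open Scope classical_set_scope.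
Local Open Scope ring_scope.

Set Implicit Arguments.
Unset Strict Implicit.
Unset Printing Implicit Defensive.

(** * Absolutely continuous functions and the metric derivative *)

Definition cumint (R : realType) (m : R -> R) (t : R) : R :=
  \int[lebesgue_measure]_(r in `]-oo, t]) m r.

Lemma cumintB (R : realType) (m : R -> R) (s t : R) :
  lebesgue_measure.-integrable setT (EFin \o m) -> s <= t ->
  cumint m t - cumint m s = \int[lebesgue_measure]_(r in `]s, t]) m r.
Proof.
move=> im st; rewrite /cumint Rintegral_itvB ?bnd_simp//.
exact: integrableS im.
Qed.

Lemma cumint_continuous (R : realType) (m : R -> R) :
  lebesgue_measure.-integrable setT (EFin \o m) -> continuous (cumint m).
Proof.
move=> im x; apply/cvgrPdist_lt => e e0.
have [d [d0 dP]] := integral_normr_continuous im e0.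
have aux (s t : R) : s <= t -> t - s < d -> `|cumint m t - cumint m s| < e.
  move=> st tsd; rewrite cumintB//.
  have imst : lebesgue_measure.-integrable `]s, t] (EFin \o m).
    exact: integrableS im.
  apply: (le_lt_trans (le_normr_Rintegral _ imst)) => //.
  apply: dP => //; rewrite [X in (X < _)%E]lebesgue_measure_itv/= lte_fin.
  by case: ifP => _; rewrite ?lte_fin// -EFinB lte_fin.
near=> y.
have xy : `|x - y| < d by near: y; exact: cvgr_dist_lt.
have [yx|/ltW xy'] := leP y x.
  by apply: aux => //; rewrite (le_lt_trans _ xy)// ler_norm.
by rewrite distrC; apply: aux => //; rewrite (le_lt_trans _ xy)// distrC ler_norm.
Unshelve. all: by end_near. Qed.

(** With [M] the primitive of [m], both [M + f] and [M - f] are nondecreasing, and their Stieltjes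
    measures add up to twice the measure of density [m]. The first is thus absolutely continuous,
    and Radon-Nikodym gives it a density [g]; the density of [f] is [g - m]. *)
Lemma ac_density (R : realType) (f m : R -> R) :
    lebesgue_measure.-integrable setT (EFin \o m) -> (forall x, 0 <= m x) ->
    (forall s t, s <= t ->
      `|f t - f s| <= \int[lebesgue_measure]_(r in `]s, t]) m r) ->
  exists2 k : R -> R, lebesgue_measure.-integrable setT (EFin \o k) &
    forall s t, s <= t -> f t - f s = \int[lebesgue_measure]_(r in `]s, t]) k r.
Proof.
move=> im m0 fm.
have imS A : measurable A -> lebesgue_measure.-integrable A (EFin \o m).
  by move=> mA; exact: integrableS im.
have cumul (g : R -> R) : (forall s t, s <= t ->
      `|g t - g s| <= \int[lebesgue_measure]_(r in `]s, t]) m r) ->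
    exists G : cumulative R R, forall t, G t = cumint m t + g t.
  move=> gm.
  have nd : {homo (fun t => cumint m t + g t) : x y / x <= y}.
    move=> s t st; have := gm _ _ st; rewrite -cumintB// ler_norml => /andP[].
    lra.
  have rc : right_continuous (fun t => cumint m t + g t).
    apply: right_continuousW => x; apply: cvgD; first exact: cumint_continuous.
    apply/cvgrPdist_lt => e e0.
    have /cvgrPdist_lt/(_ _ e0) := cumint_continuous im (x := x).
    apply: filterS => y; apply: le_lt_trans.
    have [yx|/ltW xy] := leP y x.
      by have := gm _ _ yx; rewrite -cumintB// => /le_trans; apply; exact: ler_norm.
    rewrite distrC; have := gm _ _ xy; rewrite -cumintB// => /le_trans; apply.
    by rewrite distrC ler_norm.
  pose G : cumulative R R := HB.pack (fun t => cumint m t + g t)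
    (isCumulative.Build R _ R (fun t => cumint m t + g t) nd rc).
  by exists G.
have [F FE] := cumul f fm.
have [G GE] : exists G : cumulative R R, forall t, G t = cumint m t - f t.
  have [|G GE] := cumul (fun t => - f t).
    by move=> s t st; rewrite -opprD normrN; exact: fm.
  by exists G => t; rewrite GE.
have nu0 E : (0 <= induced_charge im E)%E.
  by apply: integral_ge0 => x _; rewrite lee_fin.
pose nu : {measure set (measurableTypeR R) -> \bar R} :=
  measure_of_charge (induced_charge im) nu0.
pose muF : {measure set (measurableTypeR R) -> \bar R} :=
  lebesgue_stieltjes_measure F.
pose muG : {measure set (measurableTypeR R) -> \bar R} :=
  lebesgue_stieltjes_measure G.
have nu_itv (s t : R) : s <= t -> nu `]s, t]%classic = (cumint m t - cumint m s)%:E.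
  move=> st; rewrite cumintB// /Rintegral fineK//.
  by apply: integrable_fin_num => //; exact: imS.
have stieltjes_itv (H : cumulative R R) (s t : R) : s <= t ->
    lebesgue_stieltjes_measure H `]s, t]%classic = (H t - H s)%:E.
  move=> st; rewrite /lebesgue_stieltjes_measure/= /measure_extension.
  by rewrite measurable_mu_extE/= ?wlength_itv_bnd//; exact: is_ocitv.
have muF_itv (s t : R) : s <= t -> muF `]s, t]%classic = (F t - F s)%:E.
  exact: stieltjes_itv.
have muG_itv (s t : R) : s <= t -> muG `]s, t]%classic = (G t - G s)%:E.
  exact: stieltjes_itv.
have nufin A : measurable A -> (nu A < +oo)%E.
  move=> mA; rewrite ltey_eq; apply/orP; left.
  by apply: integrable_fin_num => //; exact: imS.
(* On half-open intervals the contributions of [f] and [- f] cancel; these intervals form a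
   generating family stable under intersection, so the equality extends to measurable sets. *)
have nuE A : measurable A -> (nu A + nu A = muF A + muG A)%E.
  pose nu2 : {measure set (measurableTypeR R) -> \bar R} := measure_add nu nu.
  pose muFG : {measure set (measurableTypeR R) -> \bar R} := measure_add muF muG.
  move=> mA; rewrite -!measure_addE.
  have ocitvE B : ocitv B -> nu2 B = muFG B.
    move=> [[a b] _ <-] /=; have [ab|ba] := leP a b; last first.
      by rewrite set_itv_ge ?measure0// bnd_simp -leNgt ltW.
    rewrite [LHS]measure_addE [RHS]measure_addE !nu_itv// muF_itv// muG_itv// -!EFinD !FE !GE.
    by congr _%:E; ring.
  pose I (k : nat) : set R := `](- k%:R), k%:R]%classic.
  have fin k : (nu2 (I k) < +oo)%E.
    by rewrite [ltLHS]measure_addE; apply: lte_add_pinfty;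
      apply: nufin; exact: measurable_itv.
  have cover : \bigcup_k I k = setT := bigcup_itvT false false.
  refine (@measure_unique _ R (measurableTypeR R) (@ocitv R) I erefl (@ocitvI R)
    (fun k => is_ocitv _ _) cover nu2 muFG ocitvE fin A mA).
have muFle A : measurable A -> (muF A <= nu A + nu A)%E.
  by move=> mA; rewrite nuE// leeDl.
have muFT : (muF setT < +oo)%E.
  by rewrite (le_lt_trans (muFle _ measurableT))//; apply: lte_add_pinfty; exact: nufin.
pose muF' : {finite_measure set (measurableTypeR R) -> \bar R} := mfrestr measurableT muFT.
have muFdom : muF' `<< (@lebesgue_measure R).
  apply/null_content_dominatesP => A mA A0.
  rewrite /muF'/= /mfrestr /mrestr setIT.
  apply/eqP; rewrite eq_le measure_ge0 andbT.
  rewrite (le_trans (muFle _ mA))//.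
  rewrite (_ : nu A = 0%E) ?adde0//.
  apply: null_set_integral => //.
  exact: measurable_int (imS _ mA).
have [h [h0 hfin ih hE]] := radon_nikodym_sigma_finite muFdom.
pose g x := fine (h x).
have ih' : lebesgue_measure.-integrable setT (EFin \o g).
  by rewrite (_ : EFin \o _ = h)//; apply/funext => x /=; rewrite fineK.
exists (fun x => g x - m x); first exact: (integrableB measurableT ih' im).
move=> s t st.
rewrite RintegralB//; [|exact: integrableS ih'|exact: imS].
rewrite -(cumintB im)//.
have := hE `]s, t]%classic (measurable_itv _).
rewrite /muF'/= /mfrestr /mrestr setIT muF_itv// !FE => hst.
rewrite [X in _ = X - _](_ : _ = cumint m t + f t - (cumint m s + f s)); first by ring.
rewrite /Rintegral (_ : (\int[lebesgue_measure]_(x in `]s, t]) (g x)%:E)%E =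
  (\int[lebesgue_measure]_(x in `]s, t]) (h x))%E); last first.
  by apply: eq_integral => x _; rewrite fineK.
by rewrite -hst.
Qed.

(** Registered so that almost everywhere statements can be handled with [near=>] and [filterS]. *)
#[global] Instance ae_lebesgue_filter (R : realType) :
  Filter (nbhs (almost_everywhere (@lebesgue_measure R))).
Proof. exact: (ae_filter_ringOfSetsType lebesgue_measure). Qed.

Lemma cumint_ae_derive (R : realType) (m : R -> R) :
  lebesgue_measure.-integrable setT (EFin \o m) ->
  {ae lebesgue_measure, forall x : R,
    (cumint m (x + h) - cumint m x) / h @[h --> 0^'] --> m x}.
Proof.
move=> im.
have /FTC1Ny : forall y : R, lebesgue_measure.-integrable `]-oo, y] (EFin \o m).
  by move=> y; exact: integrableS im.
have lm : locally_integrable setT m by apply: open_integrable_locally => //; exact: openT.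
move=> /(_ lm); apply: filterS => x [dF <-].
have -> : (fun h => (cumint m (x + h) - cumint m x) / h) =
    (fun h : R => h^-1 *: (cumint m (h + x) - cumint m x)).
  by apply/funext => h; rewrite [h + x]addrC [RHS]mulrC.
move: dF; rewrite /derivable /derive1/=.
by under eq_fun do rewrite [_ *: 1]mulr1.
Qed.

(** Monotonicity is read off the supremum over simple functions lying below, so it covers
    [metric_derivative], whose measurability is not established. *)
Lemma ge0_le_integral_measurable d (T : measurableType d) (R : realType)
    (mu : {measure set T -> \bar R}) (D : set T) (f g : T -> \bar R) :
  (forall x, D x -> (0 <= f x)%E) -> (forall x, D x -> (f x <= g x)%E) ->
  (\int[mu]_(x in D) f x <= \int[mu]_(x in D) g x)%E.
Proof.
move=> f0 fg.
have g0 x : D x -> (0 <= g x)%E by move=> Dx; exact: le_trans (f0 _ Dx) (fg _ Dx).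
rewrite !ge0_integralE//; apply: ereal_sup_le => _ [h hf <-].
exists h => // x; apply: le_trans (hf x) _.
by rewrite /patch; case: ifPn => //; rewrite inE => /fg.
Qed.

Lemma ae_le_Rintegral (R : realType) (D : set R) (f g : R -> R) :
  measurable D -> lebesgue_measure.-integrable D (EFin \o f) ->
  lebesgue_measure.-integrable D (EFin \o g) ->
  (forall x, 0 <= f x) -> (forall x, 0 <= g x) ->
  {ae lebesgue_measure, forall x : R, f x <= g x} ->
  \int[lebesgue_measure]_(x in D) f x <= \int[lebesgue_measure]_(x in D) g x.
Proof.
move=> mD If Ig f0 g0 fg; apply: fine_le.
- exact: integrable_fin_num.
- exact: integrable_fin_num.
apply: ae_ge0_le_integral => //.
- by move=> x _; rewrite lee_fin.
- exact: measurable_int If.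
- by move=> x _; rewrite lee_fin.
- exact: measurable_int Ig.
- by move: fg; apply: filterS.
Qed.

(** The speed [m] is the supremum over rationals [q] of [|k_q|], where [k_q] is the density of
    [t |-> d(x_q, x_t)]. Since [m] bounds the distance along the curve, its Lebesgue points bound
    the difference quotients from above; each [k_q] bounds them from below. *)
Lemma metric_speed (R : realType) (X : metricType R) (x : R -> X) (m0 : R -> R) :
  lebesgue_measure.-integrable setT (EFin \o m0) -> (forall t, 0 <= m0 t) ->
  (forall s t, s <= t ->
    mdist (x s) (x t) <= \int[lebesgue_measure]_(r in `]s, t]) m0 r) ->
  exists m : R -> R, [/\ forall t, 0 <= m t,
    lebesgue_measure.-integrable setT (EFin \o m),
    forall s t, s <= t ->
      mdist (x s) (x t) <= \int[lebesgue_measure]_(r in `]s, t]) m r &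
    {ae lebesgue_measure, forall t : R,
      mdist (x (t + h)) (x t) / `|h| @[h --> 0^'] --> m t}].
Proof.
move=> im0 m00 xm0.
have xm0' s t : s <= t -> mdist (x s) (x t) <= cumint m0 t - cumint m0 s.
  by move=> st; rewrite cumintB//; exact: xm0.
(* An enumeration of the rationals; codes of no rational are sent to 0. *)
pose q (n : nat) : R := ratr (odflt 0 (unpickle n)).
have revtri (a b c : X) : `|mdist a b - mdist a c| <= mdist c b.
  have := metric_triangle a c b; have := metric_triangle a b c.
  by rewrite (metric_sym b c) ler_norml; lra.
have xm0N s t : mdist (x s) (x t) <= `|cumint m0 t - cumint m0 s|.
  have [st|/ltW ts] := leP s t; first exact: le_trans (xm0' _ _ st) (ler_norm _).
  by rewrite metric_sym distrC; exact: le_trans (xm0' _ _ ts) (ler_norm _).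
have /choice[k kP] (n : nat) : exists k : R -> R,
    lebesgue_measure.-integrable setT (EFin \o k) /\
    forall s t, s <= t -> mdist (x (q n)) (x t) - mdist (x (q n)) (x s) =
      \int[lebesgue_measure]_(r in `]s, t]) k r.
  have [|k ik kE] := ac_density (f := fun t => mdist (x (q n)) (x t)) im0 m00.
    by move=> s t st; apply: le_trans (revtri _ _ _) (xm0 _ _ st).
  by exists k.
have ik n := (kP n).1.
have kE n s t : s <= t -> mdist (x (q n)) (x t) - mdist (x (q n)) (x s) =
    cumint (k n) t - cumint (k n) s.
  by move=> st; rewrite cumintB//; exact: (kP n).2.
have kE' n s t : mdist (x (q n)) (x t) - mdist (x (q n)) (x s) =
    cumint (k n) t - cumint (k n) s.
  have [st|/ltW ts] := leP s t; first exact: kE.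
  by rewrite -opprB kE// opprB.
have dm0 := cumint_ae_derive im0.
have dk : {ae lebesgue_measure, forall (t : R) n,
    (cumint (k n) (t + h) - cumint (k n) t) / h @[h --> 0^'] --> k n t}.
  by apply: ae_foralln => n; exact: cumint_ae_derive.
have km0 : {ae lebesgue_measure, forall (t : R) n, `|k n t| <= m0 t}.
  near=> t.
  have dm0t : (cumint m0 (t + h) - cumint m0 t) / h @[h --> 0^'] --> m0 t.
    by near: t; exact: dm0.
  have dkt : forall n,
      (cumint (k n) (t + h) - cumint (k n) t) / h @[h --> 0^'] --> k n t.
    by near: t; exact: dk.
  move=> n; rewrite -[leRHS]ger0_norm//.
  apply: ler_cvg_to (cvg_norm (dkt n)) (cvg_norm dm0t) _.
  near=> h; rewrite !normrM ler_wpM2r// -kE'.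
  by apply: le_trans (revtri _ _ _) _; exact: xm0N.
(* Truncation by [m0] keeps the supremum over [n] finite at every [t]; by [km0] it alters [|k n t|]
   only on a null set. *)
pose mn n t := Num.min `|k n t| (m0 t).
pose m (s : R) := sups (mn ^~ s) 0.
have mub t : has_ubound (range (mn ^~ t)).
  by exists (m0 t) => _ [n _ <-]; rewrite ge_min lexx orbT.
have mnm n t : mn n t <= m t.
  apply: ub_le_sup.
    by apply: subset_has_ubound (mub t) => _ [i _ <-]; exists i.
  by exists n.
have mm0 t : m t <= m0 t.
  apply: ge_sup; first by exists (mn 0%N t); exists 0%N.
  by move=> _ [n _ <-]; rewrite ge_min lexx orbT.
have m_ge0 t : 0 <= m t.
  by apply: le_trans (mnm 0%N t); rewrite le_min normr_ge0 m00.
have mm : measurable_fun setT m.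
  apply: measurable_fun_sups => // n; apply: measurable_minr.
    apply: measurableT_comp => //.
    by apply/measurable_EFinP; exact: measurable_int (ik n).
  by apply/measurable_EFinP; exact: measurable_int im0.
have im : lebesgue_measure.-integrable setT (EFin \o m).
  apply: le_integrable im0 => //; first exact/measurable_EFinP.
  by move=> t _; rewrite !abse_EFin lee_fin !ger0_norm.
have kmae : {ae lebesgue_measure, forall (t : R) n, `|k n t| <= m t}.
  by move: km0; apply: filterS => t kt n; apply: le_trans (mnm n t); rewrite le_min lexx kt.
(* If [s] is rational, the distance function to [x s] vanishes at [s] and its density bounds the
   distance to [x t]. A rational slightly to the right of [s] reduces the general case to this
   one. *)
have xm s t : s <= t -> mdist (x s) (x t) <= cumint m t - cumint m s.
  rewrite le_eqVlt => /predU1P[->|st]; first by rewrite mdistxx subrr.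
  apply/ler_addgt0Pr => e e0.
  have /cvgrPdist_lt/(_ _ e0)/nbhs_ballP[d /= d0 dP] := cumint_continuous im0 (x := s).
  have sd : s < Num.min t (s + d) by rewrite lt_min st ltrDl.
  have [r] := rat_in_itvoo sd; rewrite in_itv/= lt_min => /and3P[sr rt rsd].
  have qr : q (pickle r) = ratr r by rewrite /q pickleK.
  have d1 : mdist (x s) (x (ratr r)) < e.
    apply: le_lt_trans (xm0N _ _) _; rewrite distrC; apply: dP.
    by rewrite /ball/= ltr_norml; lra.
  have d2 : mdist (x (ratr r)) (x t) <= cumint m t - cumint m (ratr r).
    have := kE (pickle r) _ _ (ltW rt); rewrite qr mdistxx subr0 => ->.
    rewrite (cumintB (ik _) (ltW rt)) (cumintB im (ltW rt)).
    apply: le_trans (ler_norm _) _.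
    have ikrt : lebesgue_measure.-integrable `]ratr r, t] (EFin \o k (pickle r)).
      by apply: integrableS (ik (pickle r)).
    apply: le_trans (le_normr_Rintegral _ ikrt) _ => //.
    apply: ae_le_Rintegral => //.
    - exact: integrable_norm.
    - exact: integrableS im.
    - by move: kmae; apply: filterS.
  have d3 : cumint m s <= cumint m (ratr r).
    by rewrite -subr_ge0 (cumintB im (ltW sr)) Rintegral_ge0.
  by have := metric_triangle (x s) (x (ratr r)) (x t); lra.
exists m; split => //.
  by move=> s t st; rewrite -cumintB//; exact: xm.
have dm := cumint_ae_derive im.
near=> t.
have dmt : (cumint m (t + h) - cumint m t) / h @[h --> 0^'] --> m t.
  by near: t; exact: dm.
have dkt : forall n,
    (cumint (k n) (t + h) - cumint (k n) t) / h @[h --> 0^'] --> k n t.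
  by near: t; exact: dk.
apply/cvgrPdist_lt => e e0.
have e20 : 0 < e / 2 by rewrite divr_gt0.
(* For this [n] the quotient of the distance is squeezed between those of [cumint (k n)] and
   [cumint m], whose limits are nearly equal in absolute value. *)
have [n mnt] : exists n, m t - e / 2 < mn n t.
  have : has_sup (sdrop (mn ^~ t) 0).
    split; first by exists (mn 0%N t); exists 0%N.
    by apply: subset_has_ubound (mub t) => _ [i _ <-]; exists i.
  by move=> /(sup_adherent e20)[_ [n _ <-]]; exists n.
have knt : m t - e / 2 < `|k n t|.
  by apply: lt_le_trans mnt _; rewrite ge_min lexx.
have dm_near := (cvgrPdist_lt _ _).1 (cvg_norm dmt) _ e0.
have dk_near := (cvgrPdist_lt _ _).1 (cvg_norm (dkt n)) _ e20.
near=> h.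
have h1 : `| `|m t| - `|(cumint m (t + h) - cumint m t) / h| | < e.
  by near: h; exact: dm_near.
have h2 : `| `|k n t| - `|(cumint (k n) (t + h) - cumint (k n) t) / h| | < e / 2.
  by near: h; exact: dk_near.
have h3 : mdist (x (t + h)) (x t) / `|h| <= `|(cumint m (t + h) - cumint m t) / h|.
  rewrite normrM normfV ler_wpM2r ?invr_ge0// metric_sym.
  have [th|/ltW th] := leP t (t + h); first exact: le_trans (xm _ _ th) (ler_norm _).
  by rewrite metric_sym distrC; exact: le_trans (xm _ _ th) (ler_norm _).
have h4 : `|(cumint (k n) (t + h) - cumint (k n) t) / h| <= mdist (x (t + h)) (x t) / `|h|.
  rewrite normrM normfV ler_wpM2r ?invr_ge0// -kE'.
  by rewrite [mdist (x (t + h)) _]metric_sym; exact: revtri.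
move: h1 h2; rewrite (ger0_norm (m_ge0 t)) !ltr_norml; lra.
Unshelve. all: by end_near. Qed.

(* [lim] of a divergent filter is [point], which is 0 here: bounds on the metric
   derivative therefore hold at every point, without exceptional set. *)
Lemma metric_derivative_dvg (R : realType) (X : metricType R) (x : R -> X) t :
  ~ cvg (mdist (x (t + h)) (x t) / `|h| @[h --> 0^']) -> metric_derivative x t = 0.
Proof. by move=> /dvgP. Qed.

Lemma metric_derivative_ge0 (R : realType) (X : metricType R) (x : R -> X) t :
  0 <= metric_derivative x t.
Proof.
have [c|/metric_derivative_dvg->//] := pselect (cvg (mdist (x (t + h)) (x t) / `|h| @[h --> 0^'])).
apply: limr_ge => //; near=> h.
by rewrite divr_ge0// mdist_ge0.
Unshelve. all: by end_near. Qed.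

(** [W] is the primitive of the speed given by [metric_speed], which agrees almost everywhere on
    []0, 1[] with [metric_derivative]. *)
Lemma abs_cont_arclength (R : realType) (X : metricType R) (x : R -> X) :
  abs_cont_curve x ->
  exists W : R -> R, [/\ continuous W, {homo W : s t / s <= t},
    forall s t, 0 <= s -> s <= t -> t <= 1 -> mdist (x s) (x t) <= W t - W s &
    ((W 1 - W 0)%:E <= curve_length x)%E].
Proof.
case=> m0 im0 xm0.
(* Clamping time to [[0, 1]] extends the curve to the whole line by constants, as [metric_speed]
   requires. *)
pose c (t : R) := Num.max 0 (Num.min t 1).
have cP t : [\/ t <= 0 /\ c t = 0, 0 <= t <= 1 /\ c t = t | 1 <= t /\ c t = 1].
  rewrite /c; have [t0|t0] := leP t 0.
    by constructor 1; rewrite min_l ?max_l//; lra.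
  have [t1|t1] := leP t 1; last by constructor 3; rewrite max_r//; lra.
  by constructor 2; rewrite max_r ?ltW// t0.
have c01 t : 0 <= c t <= 1 by case: (cP t) => -[? ->]; lra.
have cE t : 0 <= t <= 1 -> c t = t.
  by move=> /andP[t0 t1]; rewrite /c min_l// max_r.
have c_nd s t : s <= t -> c s <= c t.
  by move=> st; case: (cP s) => -[? ->]; case: (cP t) => -[? ->]; lra.
pose M := (fun t => `|m0 t|) \_ `]0, 1[.
have iM : lebesgue_measure.-integrable setT (EFin \o M).
  rewrite /M -restrict_EFin; apply/integrable_restrict => //=.
  by rewrite setTI; exact: integrable_norm.
have M0 t : 0 <= M t by rewrite /M patchE; case: ifP.
have xM s t : s <= t ->
    mdist (x (c s)) (x (c t)) <= \int[lebesgue_measure]_(r in `]s, t]) M r.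
  move=> st; have [cst|cst] := ltP (c s) (c t); last first.
    have -> : c s = c t by apply/le_anti; rewrite cst c_nd.
    by rewrite mdistxx Rintegral_ge0.
  have sub01 : `]c s, c t[ `<=` `]0, 1[.
    by apply: subset_itv; rewrite bnd_simp; have := c01 s; have := c01 t; lra.
  have subst : `]c s, c t[ `<=` `]s, t].
    apply: subset_itv; rewrite bnd_simp; move: cst;
      by case: (cP s) => -[? ->]; case: (cP t) => -[? ->]; lra.
  have im0' : lebesgue_measure.-integrable `]c s, c t[ (EFin \o m0).
    exact: integrableS im0.
  apply: le_trans (xm0 _ _ _ (ltW cst) _) _; [by case/andP: (c01 s)|by case/andP: (c01 t)|].
  apply: le_trans (ler_norm _) _.
  apply: le_trans (le_normr_Rintegral _ im0') _ => //.
  rewrite (_ : \int[lebesgue_measure]_(r in `]c s, c t[) `|m0 r| =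
     \int[lebesgue_measure]_(r in `]c s, c t[) M r); last first.
    apply: eq_Rintegral => r rcst; rewrite /M patchE ifT// inE.
    by apply: sub01; rewrite inE in rcst.
  apply: fine_le.
  - by apply: integrable_fin_num => //; exact: integrableS iM.
  - by apply: integrable_fin_num => //; exact: integrableS iM.
  apply: ge0_subset_integral => //.
  - by apply: measurable_int; apply: integrableS iM.
  - by move=> r _; rewrite lee_fin.
have [m [m_ge0 im xm dm]] := metric_speed (x := x \o c) iM M0 xM.
exists (cumint m); split.
- exact: cumint_continuous.
- move=> s t st; rewrite -subr_ge0 cumintB//.
  exact: Rintegral_ge0.
- move=> s t s0 st t1; rewrite cumintB//; have := xm s t st => /=.
  by rewrite !cE//; apply/andP; split; lra.
rewrite cumintB// -Rintegral_itv_bndo_bndc; last exact: integrableS im.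
rewrite /Rintegral fineK; last first.
  by apply: integrable_fin_num => //; exact: integrableS im.
have mxm : {ae lebesgue_measure, forall t : R, `]0, 1[%classic t -> m t = metric_derivative x t}.
  move: dm; apply: filterS => t dmt; rewrite /= in_itv/= => /andP[t0 t1].
  rewrite /metric_derivative; apply/esym/cvg_lim => //.
  apply: cvg_trans dmt; apply: near_eq_cvg; near=> h.
  have h0 : `|h| < Num.min t (1 - t).
    by near: h; apply: dnbhs0_lt; rewrite lt_min t0 subr_gt0.
  have th : 0 <= t + h <= 1.
    by move: h0; rewrite lt_min !ltr_norml => /andP[/andP[? ?] /andP[? ?]]; lra.
  by rewrite /= (cE t) ?(cE _ th)// !ltW.
(* Outside the null set [N] the two speeds agree, and on [N] the metric derivative is still
   nonnegative: what remains is a pointwise comparison. *)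
case: mxm => N [mN N0 mxN].
rewrite (negligible_integral mN)//; last exact: integrableS im.
rewrite setDE integral_mkcondr; apply: ge0_le_integral_measurable.
  by move=> r _; rewrite patchE; case: ifP => // _; rewrite lee_fin.
move=> r r01; rewrite patchE; case: ifPn => [|_]; last first.
  by rewrite lee_fin metric_derivative_ge0.
rewrite inE => Nr; rewrite lee_fin.
have -> // : m r = metric_derivative x r.
by apply: contrapT => mxr; apply: Nr; apply: mxN => /(_ r01).
Unshelve. all: by end_near. Qed.

(** * Length distance and Lipschitz paths *)

(** Stands for a curve of length at most [c], parametrised so that no integral appears: paths can be
    cut, reversed and concatenated by elementary means. *)
Definition lip_path (R : realType) (X : metricType R) (c : R) (x y : X) : Prop :=
  exists g : R -> X, [/\ g 0 = x, g c = y &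
    forall s t, 0 <= s -> s <= t -> t <= c -> mdist (g s) (g t) <= t - s].

Section lip_path_lemmas.
Context (R : realType) (X : metricType R).
Implicit Types (a b c : R) (x y z : X).

Lemma lip_path_refl c x : lip_path c x x.
Proof. by exists (fun=> x); split => // s t _ st _; rewrite mdistxx subr_ge0. Qed.

Lemma lip_path_widen a b x y : 0 <= a -> a <= b -> lip_path a x y -> lip_path b x y.
Proof.
move=> a0 ab [g [g0 ga gl]]; exists (fun t => g (Num.min t a)); split.
- by rewrite min_l.
- by rewrite min_r.
move=> s t s0 st tb.
have [ta|ta] := leP t a; first by rewrite min_l ?(le_trans st)//; exact: gl.
have [sa|sa] := leP s a; last by rewrite mdistxx; lra.
by apply: le_trans (gl s a s0 sa (lexx _)) _; lra.
Qed.

Lemma lip_path_sym c x y : lip_path c x y -> lip_path c y x.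
Proof.
case=> g [g0 gc gl]; exists (fun t => g (c - t)); split.
- by rewrite subr0.
- by rewrite subrr.
move=> s t s0 st tc; rewrite metric_sym.
have -> : t - s = (c - s) - (c - t) by ring.
by apply: gl; lra.
Qed.

Lemma lip_path_cat a b x y z : 0 <= a -> 0 <= b ->
  lip_path a x y -> lip_path b y z -> lip_path (a + b) x z.
Proof.
move=> a0 b0 [g [g0 ga gl]] [h [h0 hb hl]].
pose k t := if t <= a then g t else h (t - a).
have kh t : a <= t -> k t = h (t - a).
  rewrite /k => at_; case: ifP => // ta.
  have -> : t = a by apply/le_anti; rewrite ta at_.
  by rewrite subrr ga h0.
exists k; split; first by rewrite /k a0.
  by rewrite kh ?lerDl// [a + b]addrC addrK.
move=> s t s0 st tab; have [ta|/ltW at_] := leP t a.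
  by rewrite /k ta (le_trans st ta); exact: gl.
have [sa|/ltW as_] := leP s a; last first.
  rewrite !kh//; have -> : t - s = (t - a) - (s - a) by ring.
  by apply: hl; lra.
apply: le_trans (metric_triangle _ (k a) _) _.
have -> : k s = g s by rewrite /k sa.
have -> : k a = y by rewrite /k lexx.
rewrite (kh t at_).
have ta0 : 0 <= t - a by lra.
have tb : t - a <= b by lra.
have := gl s a s0 sa (lexx _); have := hl 0 (t - a) (lexx _) ta0 tb.
rewrite h0 ga; lra.
Qed.

Lemma lip_path_cut a b x z : 0 <= a -> 0 <= b -> lip_path (a + b) x z ->
  exists y, lip_path a x y /\ lip_path b y z.
Proof.
move=> a0 b0 [g [g0 gab gl]]; exists (g a); split.
  by exists g; split => // s t s0 st ta; apply: gl => //; lra.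
exists (fun t => g (a + t)); split => //; first by rewrite addr0.
move=> s t s0 st tb; have -> : t - s = (a + t) - (a + s) by ring.
by apply: gl; lra.
Qed.

Lemma mdist_lip_path c x y : 0 <= c -> lip_path c x y -> mdist x y <= c.
Proof.
by move=> c0 [g [<- <- gl]]; have := gl 0 c (lexx _) c0 (lexx _); rewrite subr0.
Qed.

(* Generalised inverse of the possibly discontinuous [T] as a new time. *)
Lemma lip_path_reparam (a b : R) (y : R -> X) (T : R -> R) : a <= b ->
  (forall p e, a <= p <= b -> 0 < e -> exists2 d, 0 < d &
    forall q, a <= q <= b -> `|q - p| < d -> mdist (y p) (y q) < e) ->
  (forall p q, a <= p -> p < q -> q <= b -> T p < T q) ->
  (forall p q, a <= p -> p < q -> q <= b -> mdist (y p) (y q) <= T q - T p) ->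
  lip_path (T b - T a) (y a) (y b).
Proof.
move=> ab cy Tinc yT.
have Tle p q : a <= p -> p <= q -> q <= b -> T p <= T q.
  by move=> ap; rewrite le_eqVlt => /predU1P[->//|pq] qb; apply/ltW/Tinc.
pose A tau := [set s | a <= s <= b /\ T s <= tau + T a].
have Asup tau : 0 <= tau -> has_sup (A tau).
  move=> tau0; split; first by exists a; rewrite /A/=; split; lra.
  by exists b => s [/andP[]].
pose sg tau := sup (A tau).
have sg_bnd tau : 0 <= tau -> a <= sg tau <= b.
  move=> tau0; apply/andP; split.
    by apply: ub_le_sup; [exact: (Asup _ tau0).2|rewrite /A/=; split; lra].
  by apply: ge_sup; [exact: (Asup _ tau0).1|move=> s [/andP[]]].
have sg_lt tau s : 0 <= tau -> a <= s -> s < sg tau -> T s <= tau + T a.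
  move=> tau0 as_ ssg.
  have e0 : 0 < sg tau - s by rewrite subr_gt0.
  have [r [/andP[ar rb] Tr]] := sup_adherent e0 (Asup _ tau0).
  rewrite -/(sg tau) => sr; apply: le_trans Tr; apply: Tle => //; lra.
have sg_gt tau s : 0 <= tau -> sg tau < s -> s <= b -> tau + T a < T s.
  move=> tau0 sgs sb; rewrite ltNge; apply/negP => Ts.
  have /andP[sga _] := sg_bnd _ tau0.
  have : s <= sg tau.
    by apply: ub_le_sup; [exact: (Asup _ tau0).2|split => //; lra].
  lra.
have Tab : 0 <= T b - T a by rewrite subr_ge0 Tle.
exists (y \o sg); split.
- congr y; apply/eqP; rewrite eq_le; have /andP[-> sgb] := sg_bnd 0 (lexx _).
  rewrite andbT leNgt; apply/negP => asg.
  have h1 : T ((a + sg 0) / 2) <= 0 + T a by apply: sg_lt; lra.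
  have h2 : T a < T ((a + sg 0) / 2) by apply: Tinc; lra.
  lra.
- congr y; apply/eqP; rewrite eq_le; have /andP[sga ->] := sg_bnd _ Tab.
  apply: ub_le_sup; first exact: (Asup _ Tab).2.
  by rewrite /A/=; split; lra.
move=> s t s0 st tT; have t0 := le_trans s0 st.
have /andP[as_ sb] := sg_bnd _ s0; have /andP[at_ tb] := sg_bnd _ t0.
have sgst : sg s <= sg t.
  rewrite leNgt; apply/negP => sgts.
  have h1 : T ((sg s + sg t) / 2) <= s + T a by apply: sg_lt; lra.
  have h2 : t + T a < T ((sg s + sg t) / 2) by apply: sg_gt; lra.
  lra.
move: sgst; rewrite le_eqVlt => /predU1P[/= ->|sgst]; first by rewrite mdistxx subr_ge0.
apply/ler_addgt0Pr => e e0; have e20 : 0 < e / 2 by rewrite divr_gt0.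
have [|d d0 dP] := cy (sg s) (e / 2) _ e20; first by rewrite as_.
have [|d' d'0 d'P] := cy (sg t) (e / 2) _ e20; first by rewrite at_.
(* [T] may jump at [sg s] and [sg t], so the estimate is made at points moved inwards by [l], at a
   cost controlled by the continuity of [y]. The factor 3 keeps these points in order. *)
pose l := Num.min (Num.min (d / 2) (d' / 2)) ((sg t - sg s) / 3).
have l0 : 0 < l by rewrite /l !lt_min !divr_gt0//= subr_gt0.
have [[ld ld'] lst] : (l <= d / 2 /\ l <= d' / 2) /\ l <= (sg t - sg s) / 3.
  by rewrite /l !ge_min !lexx !orbT.
have h1 : mdist (y (sg s)) (y (sg s + l)) < e / 2.
  by apply: dP; [lra|rewrite ltr_norml; lra].
have h2 : mdist (y (sg t)) (y (sg t - l)) < e / 2.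
  by apply: d'P; [lra|rewrite ltr_norml; lra].
have h3 : mdist (y (sg s + l)) (y (sg t - l)) <= T (sg t - l) - T (sg s + l).
  by apply: yT; lra.
have h4 : s + T a < T (sg s + l) by apply: sg_gt => //; lra.
have h5 : T (sg t - l) <= t + T a by apply: sg_lt => //; lra.
have := metric_triangle (y (sg s)) (y (sg s + l)) (y (sg t)).
have := metric_triangle (y (sg s + l)) (y (sg t - l)) (y (sg t)).
rewrite (metric_sym (y (sg t - l)) (y (sg t))) /=; lra.
Qed.

End lip_path_lemmas.

(** Rescaled to [[0, 1]], the path has metric derivative at most [c] at every point. *)
Lemma lip_path_length (R : realType) (X : metricType R) (c : R) (x y : X) :
  0 <= c -> lip_path c x y -> (length_dist x y <= c%:E)%E.
Proof.
move=> c0 [g [g0 gc gl]].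
have gcl s t : 0 <= s -> s <= t -> t <= 1 -> mdist (g (c * s)) (g (c * t)) <= c * (t - s).
  by move=> s0 st t1; rewrite mulrBr; apply: gl; [exact: mulr_ge0|exact: ler_wpM2l|exact: ler_piMr].
pose h t := g (c * t).
have ic : lebesgue_measure.-integrable `]0%R, 1%R[ (EFin \o (cst c : R -> R)).
  have : lebesgue_measure.-integrable `[0%R, 1%R] (EFin \o (cst c : R -> R)).
    apply: continuous_compact_integrable; first exact: segment_compact.
    by apply: continuous_subspaceT => z; exact: cvg_cst.
  by apply: integrableS => //; exact: subset_itv_oo_cc.
have hac : abs_cont_curve h.
  exists (cst c) => //.
  move=> s t s0 st t1; rewrite Rintegral_cst//=.
  rewrite lebesgue_measure_itv/= lte_fin.
  apply: le_trans (gcl _ _ s0 st t1) _; rewrite ler_wpM2l//.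
  by case: ltP => //=; lra.
apply: (@le_trans _ _ (curve_length h)).
  by apply: ereal_inf_lbound; exists h => //; split => //; rewrite /h ?mulr0 ?mulr1.
apply: (@le_trans _ _ (\int[lebesgue_measure]_(t in `]0%R, 1%R[) (cst c%:E t))%E); last first.
  rewrite integral_cst//= lebesgue_measure_itv/= lte_fin ltr01.
  by rewrite oppr0 adde0 mule1.
apply: ge0_le_integral_measurable => t; first by rewrite lee_fin metric_derivative_ge0.
rewrite /= in_itv/= => /andP[t0 t1]; rewrite lee_fin.
have [cv|/metric_derivative_dvg->//] := pselect (cvg (mdist (h (t + k)) (h t) / `|k| @[k --> 0^'])).
apply: limr_le => //; near=> k.
have k0 : k != 0 by near: k; exact: nbhs_dnbhs_neq.
have kt : `|k| < Num.min t (1 - t).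
  by near: k; apply: dnbhs0_lt; rewrite lt_min t0 subr_gt0.
move: kt; rewrite lt_min !ltr_norml => /andP[/andP[? ?] /andP[? ?]].
rewrite ler_pdivrMr ?normr_gt0//.
have [k_ge0|k_lt0] := leP 0 k.
  rewrite metric_sym; apply: le_trans (gcl _ _ _ _ _) _; [lra..|].
  by rewrite ler_wpM2l// ger0_norm//; lra.
apply: le_trans (gcl _ _ _ _ _) _; [lra..|]; rewrite ler_wpM2l// ltr0_norm//; lra.
Unshelve. all: by end_near. Qed.

(** A curve of length below [c] is reparametrised by its arclength; the strict inequality leaves
    room to make the new time strictly increasing. *)
Lemma length_lip_path (R : realType) (X : metricType R) (c : R) (x y : X) :
  (length_dist x y < c%:E)%E -> 0 <= c /\ lip_path c x y.
Proof.
move=> /ereal_inf_lt[_ [g [gac g0 g1] <-] gc].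
have [W [cW ndW gW Wg]] := abs_cont_arclength gac.
have W01 : W 0 <= W 1 by exact: ndW.
have Wc : W 1 - W 0 < c by rewrite -lte_fin; exact: le_lt_trans Wg gc.
split; first lra.
(* The slack [e] is spread uniformly over [[0, 1]], so that [T] is strictly increasing and
   [T 1 - T 0] is exactly [c]. *)
pose e := c - (W 1 - W 0).
have e0 : 0 < e by rewrite subr_gt0.
pose T t := W t + e * t.
have gT p q : 0 <= p -> p <= q -> q <= 1 -> mdist (g p) (g q) <= T q - T p.
  move=> p0 pq q1; apply: le_trans (gW _ _ p0 pq q1) _.
  have := ler_wpM2l (ltW e0) pq; rewrite /T; lra.
have := @lip_path_reparam R X 0 1 g T ler01; rewrite g0 g1.
have -> : T 1 - T 0 = c by rewrite /T /e; ring.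
apply.
- move=> p d /andP[p0 p1] d0.
  have /cvgrPdist_lt/(_ _ d0)/nbhs_ballP[r /= r0 rP] := cW p.
  exists r => // q /andP[q0 q1] qp.
  have Wpq : `|W p - W q| < d by apply: rP; rewrite /ball/= distrC.
  have [pq|/ltW qp'] := leP p q.
    apply: le_lt_trans (gW _ _ p0 pq q1) _; apply: le_lt_trans Wpq.
    by rewrite distrC ler_norm.
  rewrite metric_sym; apply: le_lt_trans (gW _ _ q0 qp' p1) _.
  by apply: le_lt_trans Wpq; rewrite ler_norm.
- move=> p q p0 pq q1; rewrite /T; have := ndW _ _ (ltW pq).
  have : e * p < e * q by rewrite ltr_pM2l.
  lra.
- by move=> p q p0 pq q1; apply: gT => //; exact: ltW.
Qed.

(** * Dini derivatives *)

(** Bounds the upper right Dini derivative at [s] by the real [c], without division or infinite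
    values. *)
Definition dini_le (R : realType) (f : R -> R) (s c : R) : Prop :=
  forall e, 0 < e -> exists2 d, 0 < d &
    forall h, 0 < h -> h < d -> f (s + h) <= f s + (c + e) * h.

(** For each slope [e > 0], consider the last time up to which [f] stays below the line of slope [e]
    starting at [(a, f a)]. Continuity keeps the bound at that time, and the Dini bound continues it
    further unless the time is [b]. *)
Lemma dini_nonincreasing (R : realType) (f : R -> R) (a b : R) : a <= b ->
  (forall x, a <= x <= b -> {for x, continuous f}) ->
  (forall x, a <= x -> x < b -> dini_le f x 0) -> f b <= f a.
Proof.
move=> ab cf df; apply/ler_addgt0Pr => e0 e0_gt0.
(* The added 1 keeps the denominator positive when [a = b]. *)
pose e := e0 / (b - a + 1).
have ba1 : 0 < b - a + 1 by lra.
have e_gt0 : 0 < e by rewrite divr_gt0.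
suff : f b <= f a + e * (b - a).
  move=> /le_trans; apply; rewrite lerD2l /e mulrAC ler_pdivrMr//.
  by rewrite ler_wpM2l// ?ltW//; lra.
pose P r := f r <= f a + e * (r - a).
pose A := [set s | a <= s <= b /\ forall r, a <= r <= s -> P r].
have Aa : A a.
  rewrite /A/=; split; first lra; move=> r ra; have -> : r = a by lra.
  by rewrite /P subrr mulr0 addr0.
have supA : has_sup A by split; [exists a|exists b => s [/andP[]]].
pose s := sup A.
have as_ : a <= s by apply: ub_le_sup; [exact: supA.2|].
have sb : s <= b by apply: ge_sup; [exact: supA.1|move=> r [/andP[]]].
have Plt r : a <= r -> r < s -> P r.
  move=> ar rs; have rs0 : 0 < s - r by rewrite subr_gt0.
  have [r' [_ Pr']] := sup_adherent rs0 supA; rewrite -/s => rr'.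
  by apply: Pr'; lra.
have Ps : P s.
  rewrite /P leNgt; apply/negP => fs.
  have [sa|sa] := leP s a.
    have sE : s = a by lra.
    by move: fs; rewrite sE subrr; lra.
  have gap : 0 < f s - (f a + e * (s - a)) by rewrite subr_gt0.
  have /cvgrPdist_lt/(_ _ gap)/nbhs_ballP[d /= d0 dP] : {for s, continuous f}.
    by apply: cf; rewrite as_.
  pose r := Num.max a (s - d / 2).
  have ar : a <= r by rewrite /r le_max lexx.
  have rs : r < s by rewrite /r gt_max sa/=; lra.
  have rd : s - d / 2 <= r by rewrite /r le_max lexx orbT.
  have := Plt _ ar rs; rewrite /P => Pr.
  have : `|f s - f r| < f s - (f a + e * (s - a)).
    by apply: dP; rewrite /ball/= ltr_norml; lra.
  rewrite ltr_norml => /andP[_]; have : e * (r - a) < e * (s - a) by rewrite ltr_pM2l//; lra.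
  lra.
have [bs|sltb] := leP b s; first by rewrite (_ : b = s); [exact: Ps|lra].
have [d d0 dP] := df _ as_ sltb _ e_gt0.
pose h := Num.min (d / 2) (b - s).
have h0 : 0 < h by rewrite lt_min divr_gt0//= subr_gt0.
have hd : h <= d / 2 by rewrite /h ge_min lexx.
have hb : h <= b - s by rewrite /h ge_min lexx orbT.
have : A (s + h).
  split; first lra; move=> r /andP[ar rsh].
  have [rs|sr] := leP r s.
    have [->//|rs'] := eqVneq r s.
    by apply: Plt => //; rewrite lt_neqAle rs'.
  have := dP (r - s); rewrite add0r subrKC => H.
  have := H _ _; move: Ps; rewrite /P.
  have H' : f r <= f s + e * (r - s) by apply: H; lra.
  have -> : e * (r - a) = e * (r - s) + e * (s - a) by ring.
  lra.
move=> /(ub_le_sup supA.2); rewrite -/s; lra.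
Qed.

Lemma right_dini_le (R : realType) (f : R -> R) (s c : R) :
  (right_dini f s <= c%:E)%E -> dini_le f s c.
Proof.
move=> fc e e0.
have : (right_dini f s < (c + e)%:E)%E by apply: le_lt_trans fc _; rewrite lte_fin; lra.
rewrite /right_dini limf_esupE => /ereal_inf_lt[_ [V V0 <-] Vc].
have [d /= d0 dV] := V0.
exists d => // h h0 hd.
have Vh : V h by apply: dV => //=; rewrite ?sub0r ?normrN ?gtr0_norm.
have : (((f (s + h) - f s) / h)%:E < (c + e)%:E)%E.
  by apply: le_lt_trans Vc; apply: ereal_sup_ubound; exists h.
rewrite lte_fin ltr_pdivrMr//; lra.
Qed.

Lemma dini_le_derive (R : realType) (f : R -> R) (s c : R) :
  is_derive s 1 f c -> dini_le f s c.
Proof.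
move=> df e e0.
have : h^-1 *: (f (h *: 1 + s) - f s) @[h --> 0^'] --> c.
  have dfs : derivable f s 1 by exact: ex_derive.
  by rewrite -[X in _ --> X]derive_val; exact: dfs.
move=> /cvgrPdist_lt/(_ _ e0)[d /= d0 dP].
exists d => // h h0 hd.
have := dP h; rewrite /= sub0r normrN gtr0_norm// => /(_ hd).
rewrite gt_eqF// => /(_ isT); rewrite [h *: 1]mulr1 ltr_norml => /andP[+ _].
rewrite [h + s]addrC /GRing.scale/= mulrC ltrBrDr.
have -> : - e + (f (s + h) - f s) / h = ((f (s + h) - f s) / h) - e by ring.
rewrite ltrBlDr ltr_pdivrMr//; lra.
Qed.

Lemma dini_le_near (R : realType) (f : R -> R) (s c : R) :
  (forall e, 0 < e -> \forall h \near 0^'+, f (s + h) <= f s + (c + e) * h) ->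
  dini_le f s c.
Proof.
move=> H e /H[d /= d0 dP]; exists d => // h h0 hd.
by apply: dP => //=; rewrite sub0r normrN gtr0_norm.
Qed.

Lemma dini_leD (R : realType) (f g : R -> R) (s c c' : R) :
  dini_le f s c -> dini_le g s c' -> dini_le (fun r => f r + g r) s (c + c').
Proof.
move=> df dg e e0; have e20 : 0 < e / 2 by rewrite divr_gt0.
have [d d0 dP] := df _ e20; have [d' d'0 dP'] := dg _ e20.
exists (Num.min d d'); first by rewrite lt_min d0.
move=> h h0; rewrite lt_min => /andP[hd hd'].
by have := dP _ h0 hd; have := dP' _ h0 hd'; lra.
Qed.

Lemma is_derive_expR_scale (R : realType) (lambda s : R) :
  is_derive s 1 (fun r => expR (lambda * r)) (lambda * expR (lambda * s)).
Proof.
have dl : is_derive s 1 (lambda \*: id) (lambda *: 1) by exact: is_deriveZ.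
have := @is_derive1_comp R expR (lambda \*: id) s _ _ (is_derive_expR _) dl.
by move/is_derive_eq; apply; rewrite [lambda *: 1]mulr1 mulrC.
Qed.

Lemma dini_le_expR (R : realType) (lambda : R) (f : R -> R) (s c : R) :
  dini_le f s c ->
  dini_le (fun r => expR (lambda * r) * f r) s (expR (lambda * s) * (lambda * f s + c)).
Proof.
move=> df e e0.
pose e1 := e / 2 / expR (lambda * s).
have e10 : 0 < e1 by rewrite !divr_gt0// expR_gt0.
have e20 : 0 < e / 2 by rewrite divr_gt0.
have [d d0 dP] := df _ e10.
(* To the right of [s], [f] lies below an affine function; its product with the exponential is
   differentiable. Half of [e] pays for the affine bound, since [expR (lambda * s) * e1 = e / 2],
   and half for the derivative. *)
pose k r := expR (lambda * r) * (f s + (c + e1) * (r - s)).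
have dk : is_derive s 1 k (expR (lambda * s) * (lambda * f s + (c + e1))).
  have dl : is_derive s 1 (fun r => f s + (c + e1) * (r - s)) (c + e1).
    have := is_deriveD (is_derive_cst (f s) s 1)
      (is_deriveZ (c + e1) (is_deriveD (is_derive_id s 1) (is_derive_cst (- s) s 1))).
    by move/is_derive_eq; apply; rewrite add0r addr0 [LHS]mulr1.
  have := is_deriveM (is_derive_expR_scale lambda s) dl.
  move/is_derive_eq; apply; rewrite subrr mulr0 addr0 /GRing.scale/=; ring.
have [d' d'0 dP'] := dini_le_derive dk e20.
exists (Num.min d d'); first by rewrite lt_min d0.
move=> h h0; rewrite lt_min => /andP[hd hd'].
have := dP' _ h0 hd'; rewrite /k subrr mulr0 addr0.
have -> : s + h - s = h by ring.
have := dP _ h0 hd; rewrite -(ler_pM2l (expR_gt0 (lambda * (s + h)))).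
have : expR (lambda * s) * e1 = e / 2 by rewrite /e1 mulrC divfK// gt_eqF// expR_gt0.
move=> E1.
have -> : expR (lambda * s) * (lambda * f s + (c + e1)) =
  expR (lambda * s) * (lambda * f s + c) + e / 2 by rewrite -E1; ring.
lra.
Qed.

Lemma is_derive_continuous (R : realType) (g : R -> R) (s d : R) :
  is_derive s 1 g d -> {for s, continuous g}.
Proof.
by move=> [dg _]; apply: differentiable_continuous; apply/derivable1_diffP.
Qed.

Lemma expR_scale_cvg1 (R : realType) (a : R) : expR (a * t) @[t --> 0^'+] --> (1 : R).
Proof.
have := cvg_at_right_filter (is_derive_continuous (is_derive_expR_scale a 0)).
by rewrite mulr0 expR0.
Qed.

(** * Closed form and small-time bounds for [Elambda] *)

Section Elambda_lemmas.
Context (R : realType).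
Implicit Types (lambda t s : R).

(** Closed form of [Elambda] for [t >= 0]. Unlike [Elambda], which vanishes for negative [t], it is
    differentiable at 0. *)
Definition Eprim lambda t : R :=
  if lambda == 0 then t else lambda^-1 * (expR (lambda * t) - 1).

Lemma is_derive_Eprim lambda s : is_derive s 1 (Eprim lambda) (expR (lambda * s)).
Proof.
rewrite /Eprim; have [->|l0] := eqVneq lambda 0.
  by rewrite mul0r expR0; exact: is_derive_id.
have := is_deriveZ lambda^-1 (is_deriveD (is_derive_expR_scale lambda s)
  (is_derive_cst (-1 : R) s 1)).
by move/is_derive_eq; apply; rewrite addr0 /GRing.scale/= mulKf.
Qed.

Lemma Elambda_Eprim lambda t : 0 <= t -> Elambda lambda t = Eprim lambda t.
Proof.
rewrite le_eqVlt => /predU1P[<-|t0].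
  rewrite /Elambda set_itv1 Rintegral_set1 /Eprim mulr0 expR0 subrr mulr0.
  by case: ifP.
have dE s : derivable (Eprim lambda) s 1 by have [] := is_derive_Eprim lambda s.
have cE s : {for s, continuous (Eprim lambda)}.
  exact: is_derive_continuous (is_derive_Eprim lambda s).
rewrite /Elambda /Rintegral.
rewrite (continuous_FTC2 (F := Eprim lambda) t0).
- by rewrite -EFinB/= /Eprim mulr0 expR0 subrr mulr0; case: ifP => _; rewrite subr0.
- apply: continuous_subspaceT => s.
  exact: is_derive_continuous (is_derive_expR_scale lambda s).
- split.
  + by move=> s _; exact: dE.
  + by apply: cvg_at_right_filter; exact: cE.
  + by apply: cvg_at_left_filter; exact: cE.
- by move=> s _; rewrite derive1E; have [_ ->] := is_derive_Eprim lambda s.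
Qed.

Lemma mul_Elambda lambda t : 0 <= t -> lambda * Elambda lambda t = expR (lambda * t) - 1.
Proof.
move=> t0; rewrite Elambda_Eprim// /Eprim; have [->|l0] := eqVneq lambda 0.
  by rewrite !mul0r expR0 subrr.
by rewrite mulVKf.
Qed.

(** With [Elambda_le], this encloses [Elambda lambda t] between multiples of [t] whose factors tend
    to 1, whatever the sign of [lambda]. Both follow from [1 + u <= e^u]. *)
Lemma Elambda_ge lambda t : 0 <= t -> t * expR (- (`|lambda| * t)) <= Elambda lambda t.
Proof.
move=> t0; have := mul_Elambda lambda t0; set E := Elambda _ _ => EE.
have tle : t * expR (- (`|lambda| * t)) <= t.
  by rewrite ler_piMr// -expR0 ler_expR oppr_le0 mulr_ge0.
have [l0|l0|l0] := ltgtP lambda 0; last first.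
- by move: tle; rewrite /E Elambda_Eprim// /Eprim l0 eqxx.
- apply: le_trans tle _; rewrite -(ler_pM2l l0) EE.
  by have := expR_ge1Dx (lambda * t); lra.
- have l0' : 0 < - lambda by rewrite oppr_gt0.
  rewrite -(ler_pM2l l0') mulNr (mulNr _ E) EE ltr0_norm// mulNr opprK.
  have H : (1 - lambda * t) * expR (lambda * t) <= 1.
    rewrite -[leRHS](expR0 R) -(addNr (lambda * t)) expRD ler_pM2r ?expR_gt0//.
    exact: expR_ge1Dx.
  lra.
Qed.

Lemma Elambda_le lambda t : 0 <= t -> Elambda lambda t <= t * expR (`|lambda| * t).
Proof.
move=> t0; have := mul_Elambda lambda t0; set E := Elambda _ _ => EE.
have tle : t <= t * expR (`|lambda| * t).
  by rewrite ler_peMr// -expR0 ler_expR mulr_ge0.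
have [l0|l0|l0] := ltgtP lambda 0; last first.
- by move: tle; rewrite /E Elambda_Eprim// /Eprim l0 eqxx.
- rewrite -(ler_pM2l l0) EE gtr0_norm//.
  have H : (1 - lambda * t) * expR (lambda * t) <= 1.
    rewrite -[leRHS](expR0 R) -(addNr (lambda * t)) expRD ler_pM2r ?expR_gt0//.
    exact: expR_ge1Dx.
  lra.
- apply: le_trans tle; have l0' : 0 < - lambda by rewrite oppr_gt0.
  rewrite -(ler_pM2l l0') mulNr EE.
  by have := expR_ge1Dx (lambda * t); lra.
Qed.

Lemma Elambda_gt0 lambda t : 0 < t -> 0 < Elambda lambda t.
Proof.
by move=> t0; apply: lt_le_trans (Elambda_ge _ (ltW t0)); rewrite mulr_gt0// expR_gt0.
Qed.

Lemma expRN_Elambda lambda t : 0 <= t ->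
  expR (- (lambda * t)) * Elambda lambda t = Elambda (- lambda) t.
Proof.
move=> t0; rewrite !Elambda_Eprim// /Eprim oppr_eq0.
have [->|l0] := eqVneq lambda 0; first by rewrite mul0r oppr0 expR0 mul1r.
rewrite mulNr expRN; field; rewrite l0/=.
by rewrite gt_eqF// expR_gt0.
Qed.

End Elambda_lemmas.

(** * Evolution variational inequalities *)

Lemma dini_leW (R : realType) (f : R -> R) (s c c' : R) :
  c <= c' -> dini_le f s c -> dini_le f s c'.
Proof.
move=> cc' df e e0; have [d d0 dP] := df _ e0; exists d => // h h0 hd.
apply: le_trans (dP _ h0 hd) _; rewrite lerD2l ler_pM2r//; lra.
Qed.

Lemma mdist_sq_cvg (R : realType) (X : metricType R) (T : Type) (F : set_system T)
    {FF : Filter F} (f g : T -> X) (x y : X) :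
  (forall e, 0 < e -> \forall t \near F, mdist x (f t) < e) ->
  (forall e, 0 < e -> \forall t \near F, mdist y (g t) < e) ->
  mdist (f t) (g t) ^+ 2 @[t --> F] --> mdist x y ^+ 2.
Proof.
move=> fx gy.
suff H : mdist (f t) (g t) @[t --> F] --> mdist x y.
  by rewrite expr2; under eq_fun do rewrite expr2; exact: cvgM.
apply/cvgrPdist_lt => e e0; have e20 : 0 < e / 2 by rewrite divr_gt0.
near=> t.
have h1 : mdist x (f t) < e / 2 by near: t; exact: fx.
have h2 : mdist y (g t) < e / 2 by near: t; exact: gy.
have h3 := metric_triangle x (f t) y; have h4 := metric_triangle (f t) (g t) y.
have h5 := metric_triangle (f t) x (g t); have h6 := metric_triangle x y (g t).
move: h3 h4 h5 h6; rewrite (metric_sym (f t) x) (metric_sym (g t) y) ltr_norml; lra.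
Unshelve. all: by end_near. Qed.

Lemma lsc_fine_near (R : realType) (X : metricType R) (phi : X -> \bar R) (x : X) (e : R) :
  (forall x, (-oo < phi x)%E) -> lower_semicontinuous phi -> Dom phi x -> 0 < e ->
  exists2 r, 0 < r & forall y, mdist x y < r -> ((fine (phi x) - e)%:E < phi y)%E.
Proof.
move=> gtN lsc dx e0.
have px : phi x = (fine (phi x))%:E by rewrite fineK// fin_real// gtN.
have [V /nbhs_ballP[r /= r0 rV] VP] : exists2 V, nbhs x V &
    forall y, V y -> ((fine (phi x) - e)%:E < phi y)%E.
  by apply: lsc; rewrite px lte_fin; lra.
by exists r => // y xy; apply: VP; apply: rV; rewrite ballEmdist.
Qed.

Section EVI.
Context (R : realType) (X : metricType R) (phi : X -> \bar R) (lambda : R).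
Hypothesis phi_gtNy : forall x, (-oo < phi x)%E.
Hypothesis phi_lsc : lower_semicontinuous phi.

Local Notation f x := (fine (phi x)).

Lemma Dom_fine x : Dom phi x -> phi x = (f x)%:E.
Proof. by move=> dx; rewrite fineK// fin_real// phi_gtNy. Qed.

Section solution.
Context (u : R -> X).
Hypothesis usol : EVI_solution phi lambda u.

Lemma EVI_solution_dini t v : 0 < t -> Dom phi v ->
  dini_le (fun s => mdist (u s) v ^+ 2) t
    (2 * (f v - f (u t)) - lambda * mdist (u t) v ^+ 2).
Proof.
move=> t0 dv; apply: right_dini_le.
have := EVI_ineq usol t0 dv; rewrite (Dom_fine dv) (Dom_fine (EVI_dom usol t0)).
(* The value [-oo] satisfies any bound; [+oo] contradicts EVI, whose right-hand side is finite
   here. *)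
case: (right_dini _ _) => [r| |] /=; last by rewrite leNye.
- by rewrite -EFinM -EFinB -EFinD !lee_fin; lra.
- by rewrite gt0_muley ?lte_fin// addye// -EFinB leye_eq.
Qed.

Lemma EVI_solution_near (t e : R) : 0 < t -> 0 < e ->
  \forall s \near t, mdist (u t) (u s) < e.
Proof.
move=> t0 e0.
have ct : {for t, continuous u}.
  have := EVI_continuous usol; rewrite continuous_open_subspace; last exact: interval_open.
  by move=> /(_ t); apply; rewrite inE/= in_itv/= t0.
have /ct : nbhs (u t) (ball (u t) e) by exact: nbhsx_ballx.
by rewrite ballEmdist.
Qed.

Lemma EVI_solution_continuous t v : 0 < t ->
  {for t, continuous (fun s => mdist (u s) v ^+ 2)}.
Proof.
move=> t0; apply: mdist_sq_cvg => e e0; first exact: EVI_solution_near.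
by apply: nearW => _; rewrite mdistxx.
Qed.

(** The factor [e^(lambda r)] absorbs the term in [lambda d^2]. A constant bound [K] takes the place
    of an integral of [phi] along the solution. *)
Lemma EVI_solution_potential_dini t v K : 0 < t -> Dom phi v ->
  f v - f (u t) <= K ->
  dini_le (fun r => expR (lambda * r) * mdist (u r) v ^+ 2 - 2 * K * Eprim lambda r) t 0.
Proof.
move=> t0 dv uK.
have dE := is_deriveZ (- (2 * K)) (is_derive_Eprim lambda t).
have := dini_leD (dini_le_expR lambda (EVI_solution_dini t0 dv)) (dini_le_derive dE).
rewrite [X in dini_le X _ 0](_ : _ = fun r => expR (lambda * r) * mdist (u r) v ^+ 2 +
    (- (2 * K) \*: Eprim lambda) r); last first.
  by apply/funext => r /=; rewrite [_ *: _]mulNr.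
apply: dini_leW; rewrite /GRing.scale/=.
have := expR_gt0 (lambda * t); set E := expR _ => E0.
have -> : E * (lambda * mdist (u t) v ^+ 2 +
  (2 * (f v - f (u t)) - lambda * mdist (u t) v ^+ 2)) + - (2 * K) * E =
  E * (2 * (f v - f (u t) - K)) by ring.
by rewrite pmulr_rle0//; lra.
Qed.

Lemma EVI_solution_potential s t v K : 0 < s -> s <= t -> Dom phi v ->
  (forall r, s <= r -> r < t -> f v - f (u r) <= K) ->
  expR (lambda * t) * mdist (u t) v ^+ 2 - 2 * K * Eprim lambda t <=
  expR (lambda * s) * mdist (u s) v ^+ 2 - 2 * K * Eprim lambda s.
Proof.
move=> s0 st dv H.
apply: (dini_nonincreasing (f := fun r =>
  expR (lambda * r) * mdist (u r) v ^+ 2 - 2 * K * Eprim lambda r)) => //.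
  move=> r /andP[sr _].
  apply: cvgB; first apply: cvgM.
  - exact: is_derive_continuous (is_derive_expR_scale lambda r).
  - by apply: EVI_solution_continuous; lra.
  - by apply: cvgM; [exact: cvg_cst|exact: is_derive_continuous (is_derive_Eprim lambda r)].
move=> r sr rt; apply: EVI_solution_potential_dini => //; first lra.
exact: H.
Qed.

(** If the energy increased, let [r] be the last time at which it is at most the mean [c] of its end
    values. EVI tested against [u r] itself then prevents the solution from leaving [u r], although
    its energy at [t] exceeds [c]. *)
Lemma EVI_solution_nonincreasing s t : 0 < s -> s <= t -> f (u t) <= f (u s).
Proof.
move=> s0 st; rewrite leNgt; apply/negP => fst.
pose c := (f (u s) + f (u t)) / 2.
pose A := [set r | s <= r <= t /\ f (u r) <= c].
have supA : has_sup A.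
  split; first by exists s; rewrite /A/= /c; split; lra.
  by exists t => r [/andP[]].
pose r := sup A.
have As : A s by rewrite /A/= /c; split; lra.
have sr : s <= r by apply: ub_le_sup; [exact: supA.2|].
have rt : r <= t by apply: ge_sup; [exact: supA.1|move=> q [/andP[]]].
have r0 : 0 < r by lra.
have Dr q : s <= q -> Dom phi (u q) by move=> sq; apply: (EVI_dom usol); lra.
(* The supremum is attained, by lower semicontinuity of [phi] and continuity of [u]. *)
have frc : f (u r) <= c.
  rewrite leNgt; apply/negP => cfr.
  have e0 : 0 < f (u r) - c by rewrite subr_gt0.
  have [d d0 dP] := lsc_fine_near phi_gtNy phi_lsc (Dr _ sr) e0.
  have /nbhs_ballP[d' /= d'0 d'P] := EVI_solution_near r0 d0.
  have [q [/andP[sq qt] fq] rq] := sup_adherent d'0 supA.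
  have qr : q <= r by apply: ub_le_sup; [exact: supA.2|rewrite /A/= sq qt].
  have /dP : mdist (u r) (u q) < d.
    by apply: d'P; rewrite /ball/= ltr_norml; move: rq; rewrite -/r; lra.
  by rewrite (Dom_fine (Dr _ sq)) lte_fin => ?; lra.
have fgt q : r < q -> q <= t -> c < f (u q).
  move=> rq qt; rewrite ltNge; apply/negP => fq.
  have : q <= r.
    apply: ub_le_sup; first exact: supA.2.
    by rewrite /A/= qt andbT; split => //; lra.
  lra.
have := @EVI_solution_potential r t (u r) 0 r0 rt (Dr _ sr).
rewrite !(mulr0, mul0r, subr0) mdistxx expr0n/= mulr0 => H.
have {H} : expR (lambda * t) * mdist (u t) (u r) ^+ 2 <= 0.
  apply: H => q rq qt; have [->|qr] := eqVneq q r; first by rewrite subrr.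
  have : c < f (u q) by apply: fgt; [rewrite lt_neqAle eq_sym qr|exact: ltW].
  lra.
rewrite pmulr_rle0 ?expR_gt0// => d0.
have /eqP : mdist (u t) (u r) ^+ 2 == 0 by rewrite eq_le d0 sqr_ge0.
move=> /eqP; rewrite sqrf_eq0 => /eqP/mdist_positivity utr.
by move: fst frc; rewrite /c utr => *; lra.
Qed.

Lemma EprimB s t : Eprim lambda t - Eprim lambda s = expR (lambda * s) * Eprim lambda (t - s).
Proof.
rewrite /Eprim; case: eqVneq => [->|l0]; first by rewrite mul0r expR0 mul1r.
have -> : expR (lambda * t) = expR (lambda * s) * expR (lambda * (t - s)).
  by rewrite -expRD -mulrDr subrKC.
ring.
Qed.

(** As the energy decreases along [u], its value at [t] provides the constant [K] for the whole
    interval. *)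
Lemma EVI_solution_integral s t v : 0 < s -> s <= t -> Dom phi v ->
  expR (lambda * (t - s)) * mdist (u t) v ^+ 2 - mdist (u s) v ^+ 2
  <= 2 * Elambda lambda (t - s) * (f v - f (u t)).
Proof.
move=> s0 st dv; rewrite Elambda_Eprim ?subr_ge0//.
have H : forall r, s <= r -> r < t -> f v - f (u r) <= f v - f (u t).
  move=> r sr rt; rewrite lerD2l lerN2.
  by apply: EVI_solution_nonincreasing; lra.
have := EVI_solution_potential s0 st dv H; set K := f v - f (u t).
have -> : expR (lambda * t) = expR (lambda * s) * expR (lambda * (t - s)).
  by rewrite -expRD -mulrDr subrKC.
have := EprimB s t; set E := expR (lambda * s) => EB H1.
have E0 : 0 < E by exact: expR_gt0.
rewrite -(ler_pM2l E0).
have -> : E * (2 * Eprim lambda (t - s) * K) = 2 * K * (E * Eprim lambda (t - s)) by ring.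
rewrite -EB; lra.
Qed.

End solution.
End EVI.

(** * Integrated EVI from time 0 and contraction of the flow *)

Section EVI_flow.
Context (R : realType) (X : metricType R) (phi : X -> \bar R) (lambda : R).
Context (D : set X) (S : R -> X -> X).
Hypothesis phi_gtNy : forall x, (-oo < phi x)%E.
Hypothesis phi_lsc : lower_semicontinuous phi.
Hypothesis S_flow : EVI_flow phi lambda D S.

Local Notation f x := (fine (phi x)).

Lemma EVI_flow_near0 x e : D x -> 0 < e -> \forall t \near 0^'+, mdist x (S t x) < e.
Proof.
move=> Dx e0.
have /(EVI_flow_lim S_flow Dx) : nbhs x (ball x e) by exact: nbhsx_ballx.
by rewrite ballEmdist.
Qed.

(** Since [phi x] may be infinite and EVI is given at positive times, the estimate on [[s, t]] is
    passed to the limit [s -> 0]. *)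
Lemma EVI_flow_integral x v (t : R) : D x -> 0 < t -> Dom phi v ->
  expR (lambda * t) * mdist (S t x) v ^+ 2 - mdist x v ^+ 2
  <= 2 * Elambda lambda t * (f v - f (S t x)).
Proof.
move=> Dx t0 dv; have sol := EVI_flow_solution S_flow Dx.
rewrite (Elambda_Eprim _ (ltW t0)); set K := f v - _.
have lim0 : expR (lambda * s) * mdist (S s x) v ^+ 2 - 2 * K * Eprim lambda s
    @[s --> 0^'+] --> expR (lambda * 0) * mdist x v ^+ 2 - 2 * K * Eprim lambda 0.
  apply: cvgB; first apply: cvgM.
  - exact: cvg_at_right_filter (is_derive_continuous (is_derive_expR_scale lambda 0)).
  - apply: mdist_sq_cvg => e e0; first exact: EVI_flow_near0.
    by apply: nearW => _; rewrite mdistxx.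
  - apply: cvgM; first exact: cvg_cst.
    exact: cvg_at_right_filter (is_derive_continuous (is_derive_Eprim lambda 0)).
have Eprim0 : Eprim lambda 0 = 0.
  by rewrite /Eprim mulr0 expR0 subrr mulr0; case: ifP.
move: lim0; rewrite mulr0 expR0 mul1r Eprim0 mulr0 subr0 => lim0.
rewrite lerBlDr -lerBlDl mulrAC.
apply: cvgr_to_ge lim0 _.
near=> s.
have s0 : 0 < s by near: s; exact: nbhs_right_gt.
have st : s < t by near: s; exact: nbhs_right_lt.
apply: (EVI_solution_potential phi_gtNy sol s0 (ltW st) dv) => r sr rt.
rewrite lerD2l lerN2.
by apply: (EVI_solution_nonincreasing phi_gtNy phi_lsc sol); lra.
Unshelve. all: by end_near. Qed.

(** It suffices that [F] has nonpositive Dini derivative at positive times. A step of length [h]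
    moves first [u] to [u'], with EVI tested at [v], then [v] to [v'], with EVI tested at [u']; the
    energies cancel up to [o(h)]. *)
Lemma EVI_flow_contraction x y (t : R) : D x -> D y -> 0 <= t ->
  expR (2 * lambda * t) * mdist (S t x) (S t y) ^+ 2 <= mdist x y ^+ 2.
Proof.
move=> Dx Dy; rewrite le_eqVlt => /predU1P[<-|t0].
  by rewrite mulr0 expR0 mul1r !(EVI_flow_init S_flow).
have solx := EVI_flow_solution S_flow Dx; have soly := EVI_flow_solution S_flow Dy.
pose F r := expR (2 * lambda * r) * mdist (S r x) (S r y) ^+ 2.
have cexp r : {for r, continuous (fun r => expR (2 * lambda * r))}.
  exact: is_derive_continuous (is_derive_expR_scale (2 * lambda) r).
have F_dini r : 0 < r -> dini_le F r 0.
  move=> r0; apply: dini_le_near => e e0.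
  have du := EVI_dom solx r0; have dv := EVI_dom soly r0.
  set u := S r x in du; set v := S r y in dv.
  pose E2 := expR (2 * lambda * r).
  have E20 : 0 < E2 by exact: expR_gt0.
  (* The error found below is [8 * e1 * h], and it gets multiplied by [E2]. *)
  pose e1 := e / (8 * E2).
  have e10 : 0 < e1 by rewrite divr_gt0// mulr_gt0.
  pose K := `|f u - f v| + 1.
  have K0 : 0 < K by rewrite /K; have := normr_ge0 (f u - f v); lra.
  have [d1 d10 d1P] := lsc_fine_near phi_gtNy phi_lsc du ltr01.
  have m0 : 0 < Num.min e1 1 by rewrite lt_min e10 ltr01.
  have [d2 d20 d2P] := lsc_fine_near phi_gtNy phi_lsc dv m0.
  have /nbhs_ballP[r1 /= r10 r1P] := EVI_solution_near solx r0 d10.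
  have /nbhs_ballP[r2 /= r20 r2P] := EVI_solution_near soly r0 d20.
  pose L := 2 * `|lambda| * K + 1.
  have L0 : 0 < L by rewrite ltr_wpDl// !mulr_ge0// ltW.
  near=> h.
  have h0 : 0 < h by near: h; exact: nbhs_right_gt.
  have hr1 : h < r1 by near: h; exact: nbhs_right_lt.
  have hr2 : h < r2 by near: h; exact: nbhs_right_lt.
  have hL : h <= e1 / L by near: h; apply: nbhs_right_le; rewrite divr_gt0.
  have hK : h * (2 * `|lambda| * K) <= e1.
    move: hL; rewrite ler_pdivlMr// => /(le_trans _); apply.
    by rewrite ler_pM2l// /L lerDl.
  have hexp : expR (`|lambda| * h) <= 2.
    near: h.
    by move: (expR_scale_cvg1 `|lambda|) => /cvgr_le; apply; lra.
  have rh0 : 0 < r + h by exact: addr_gt0.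
  have rrh : r <= r + h by rewrite lerDl ltW.
  have du' := EVI_dom solx rh0; have dv' := EVI_dom soly rh0.
  set u' := S (r + h) x in du'; set v' := S (r + h) y in dv'.
  have Eh0 : 0 <= Elambda lambda h by rewrite ltW// Elambda_gt0.
  have Eh : Elambda lambda h <= 2 * h.
    apply: le_trans (Elambda_le _ (ltW h0)) _.
    by rewrite mulrC ler_pM2r.
  have fu1 : f u' <= f u.
    exact: (EVI_solution_nonincreasing phi_gtNy phi_lsc solx r0 rrh).
  have fv1 : f v' <= f v.
    exact: (EVI_solution_nonincreasing phi_gtNy phi_lsc soly r0 rrh).
  have fu2 : f u - 1 < f u'.
    rewrite -lte_fin -(Dom_fine phi_gtNy du'); apply: d1P; apply: r1P.
    by rewrite /ball/= opprD addNKr normrN gtr0_norm.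
  have fv2 : f v - Num.min e1 1 < f v'.
    rewrite -lte_fin -(Dom_fine phi_gtNy dv'); apply: d2P; apply: r2P.
    by rewrite /ball/= opprD addNKr normrN gtr0_norm.
  have mine : Num.min e1 1 <= e1 by rewrite ge_min lexx.
  have min1 : Num.min e1 1 <= 1 by rewrite ge_min lexx orbT.
  have := EVI_solution_integral phi_gtNy phi_lsc solx r0 rrh dv.
  have := EVI_solution_integral phi_gtNy phi_lsc soly r0 rrh du'.
  have -> : r + h - r = h by ring.
  rewrite -/u -/v -/u' -/v' (metric_sym v' u') (metric_sym v u').
  have := mul_Elambda lambda (ltW h0); set E := Elambda _ h in Eh0 Eh *.
  set d00 := mdist u v ^+ 2; set d10' := mdist u' v ^+ 2; set d11 := mdist u' v' ^+ 2.
  set g := expR (lambda * h) => gE H1 H2.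
  have g0 : 0 < g by exact: expR_gt0.
  (* What is left of the energies: [f v - f v'] is small by lower semicontinuity, and the other term
     is of order [h] because [K] bounds [|f u' - f v'|]. *)
  have br : (f v - f v') + lambda * E * (f u' - f v') <= 2 * e1.
    have : lambda * E * (f u' - f v') <= e1.
      apply: le_trans (ler_norm _) _; rewrite !normrM (ger0_norm Eh0).
      have uvK : `|f u' - f v'| <= K.
        have := ler_norm (f u - f v); have := ler_norm (- (f u - f v)).
        by rewrite normrN /K ler_norml; lra.
      apply: le_trans hK; rewrite (_ : h * _ = `|lambda| * (2 * h) * K); last by ring.
      by apply: ler_pM => //; [rewrite mulr_ge0|rewrite ler_wpM2l].
    lra.
  have main : g ^+ 2 * d11 <= d00 + e / E2 * h.
    have H3 : g * (g * d11) <= g * (d10' + 2 * E * (f u' - f v')).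
      by rewrite ler_pM2l//; lra.
    have H4 : E * ((f v - f v') + lambda * E * (f u' - f v')) <= 2 * h * (2 * e1).
      apply: le_trans (_ : E * (2 * e1) <= _); first by rewrite ler_wpM2l.
      by rewrite ler_wpM2r// mulr_ge0// ltW.
    have -> : e / E2 * h = 8 * e1 * h.
      by rewrite /e1; field; rewrite gt_eqF.
    have -> : g ^+ 2 * d11 = g * (g * d11) by ring.
    apply: le_trans H3 _.
    have -> : g * (d10' + 2 * E * (f u' - f v')) =
      g * d10' + 2 * E * (f u' - f v') + 2 * (lambda * E) * E * (f u' - f v') by rewrite gE; ring.
    lra.
  rewrite /F -/u -/v -/u' -/v' -/d00 -/d11 -/E2.
  have -> : expR (2 * lambda * (r + h)) = E2 * g ^+ 2.
    by rewrite /E2 /g expr2 -!expRD; congr expR; ring.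
  have := ler_wpM2l (ltW E20) main.
  have -> : E2 * (d00 + e / E2 * h) = E2 * d00 + e * h.
    by field; rewrite gt_eqF.
  by rewrite add0r mulrA.
have F_le s : 0 < s -> s <= t -> F t <= F s.
  move=> s0 st; apply: dini_nonincreasing => // [r /andP[sr rt]|r sr rt].
    by apply: cvgM; [exact: cexp|apply: mdist_sq_cvg => e e0;
      [apply: (EVI_solution_near solx)|apply: (EVI_solution_near soly)] => //; lra].
  by apply: F_dini; lra.
have lim0 : F s @[s --> 0^'+] --> expR (2 * lambda * 0) * mdist x y ^+ 2.
  apply: cvgM; first exact: (cvg_at_right_filter (cexp 0)).
  by apply: mdist_sq_cvg => e e0; exact: EVI_flow_near0.
move: lim0; rewrite mulr0 expR0 mul1r => lim0.
apply: cvgr_to_ge lim0 _.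
near=> s; apply: F_le; first by near: s; exact: nbhs_right_gt.
by near: s; exact: nbhs_right_le.
Unshelve. all: by end_near. Qed.
End EVI_flow.

(** * Convexity *)

(** When [c = a + b], the difference of the two sides is the square of
    [(1 - theta) * a - theta * b]. *)
Lemma convex_sq_triangle (R : realType) (theta a b c : R) : 0 <= theta <= 1 ->
  0 <= c -> c <= a + b ->
  theta * (1 - theta) * c ^+ 2 <= (1 - theta) * a ^+ 2 + theta * b ^+ 2.
Proof.
move=> /andP[t0 t1] c0 cab.
have cab2 : c ^+ 2 <= (a + b) ^+ 2 by rewrite lerXn2r ?nnegrE//; lra.
have t01 : 0 <= theta * (1 - theta) by rewrite mulr_ge0//; lra.
apply: le_trans (ler_wpM2l t01 cab2) _; rewrite -subr_ge0.
have -> : (1 - theta) * a ^+ 2 + theta * b ^+ 2 - theta * (1 - theta) * (a + b) ^+ 2 =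
  ((1 - theta) * a - theta * b) ^+ 2 by ring.
exact: sqr_ge0.
Qed.

(** Here [r0], [r1] are the distances from [x0], [x1] to the intermediate point, and [a], [b] those
    to its image under the flow, of energy [fy]. The coefficients [A], [B] are left free so as to
    serve both [mdist] and the length distance. *)
Lemma potential_bound (R : realType) (theta a b c r0 r1 f0 f1 fy A B de : R) :
  0 <= theta <= 1 -> 0 <= c -> c <= a + b -> 0 <= A -> 0 < B ->
  a ^+ 2 <= A * r0 ^+ 2 + 2 * B * (f0 - fy) ->
  b ^+ 2 <= A * r1 ^+ 2 + 2 * B * (f1 - fy) ->
  (1 - theta) * r0 ^+ 2 + theta * r1 ^+ 2 <= theta * (1 - theta) * c ^+ 2 * (1 + de) ->
  fy <= (1 - theta) * f0 + theta * f1
        - (1 - A * (1 + de)) / B / 2 * (theta * (1 - theta) * c ^+ 2).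
Proof.
move=> t01 c0 cab A0 B0 ha hb hr; have := convex_sq_triangle t01 c0 cab.
case/andP: t01 => t0 t1; set Q := theta * (1 - theta) * c ^+ 2 in hr * => HQ.
have ha' : (1 - theta) * a ^+ 2 <= (1 - theta) * (A * r0 ^+ 2 + 2 * B * (f0 - fy)).
  by rewrite ler_wpM2l//; lra.
have hb' : theta * b ^+ 2 <= theta * (A * r1 ^+ 2 + 2 * B * (f1 - fy)).
  by rewrite ler_wpM2l.
have hr' := ler_wpM2l A0 hr.
have B20 : 0 < 2 * B by lra.
rewrite -(ler_pM2l B20).
have -> : 2 * B * ((1 - theta) * f0 + theta * f1 - (1 - A * (1 + de)) / B / 2 * Q) =
  2 * B * ((1 - theta) * f0 + theta * f1) - (1 - A * (1 + de)) * Q.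
  by field; rewrite gt_eqF.
lra.
Qed.

(* Once the time [t] is fixed, the accuracy [de] of the intermediate point is
   chosen so small that it is negligible with respect to [B t]. *)
Lemma approx_convex_params (R : realType) (lambda theta eps c f0 f1 K t1 : R)
    (A B : R -> R) : 0 < theta < 1 -> 0 < eps -> 0 < c -> 0 < t1 ->
  (forall eta, 0 < eta -> exists2 t0, 0 < t0 & forall t, 0 < t -> t < t0 ->
    [/\ 0 <= A t, A t <= 1 + eta, 0 < B t, B t <= eta &
        (lambda - eta) * B t <= 1 - A t]) ->
  exists t de, [/\ 0 < t, t < t1, 0 < de &
    forall a b r0 r1 fy, c <= a + b ->
    a ^+ 2 <= A t * r0 ^+ 2 + 2 * B t * (f0 - fy) ->
    b ^+ 2 <= A t * r1 ^+ 2 + 2 * B t * (f1 - fy) ->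
    (1 - theta) * r0 ^+ 2 + theta * r1 ^+ 2 <= theta * (1 - theta) * c ^+ 2 * (1 + de) ->
    K <= fy ->
    a ^+ 2 / theta + b ^+ 2 / (1 - theta) <= c ^+ 2 * (1 + eps ^+ 2 * theta * (1 - theta)) /\
    fy <= (1 - theta) * f0 + theta * f1
          - (lambda - eps) / 2 * theta * (1 - theta) * c ^+ 2].
Proof.
move=> /andP[th0 th1] e0 c0 t10 AB.
have th1' : 0 < 1 - theta by lra.
have c20 : 0 < c ^+ 2 by rewrite exprn_gt0.
pose P := `|f0 - K| / theta + `|f1 - K| / (1 - theta).
have P0 : 0 <= P by rewrite addr_ge0// divr_ge0// ltW.
pose kap := eps ^+ 2 * theta * (1 - theta).
have kap0 : 0 < kap by rewrite !mulr_gt0.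
(* The last bound preserves the intermediate point: [3 * c ^+ 2] comes from
   [(1 + eta)^2 <= 1 + 3 eta], and [2 * P] from the energy drop, limited by the lower bound [K]. The
   bound [eps / 2] serves the convexity inequality. *)
pose eta := Num.min (Num.min 1 (eps / 2)) (kap * c ^+ 2 / (3 * c ^+ 2 + 2 * P)).
have den0 : 0 < 3 * c ^+ 2 + 2 * P by lra.
have eta0 : 0 < eta by rewrite !lt_min ltr01 !divr_gt0// mulr_gt0.
have [[eta1 etae] etak] : (eta <= 1 /\ eta <= eps / 2) /\
    eta * (3 * c ^+ 2 + 2 * P) <= kap * c ^+ 2.
  by rewrite -ler_pdivlMr// /eta !ge_min !lexx !orbT.
have [t0 t00 t0P] := AB _ eta0.
pose t := Num.min (t0 / 2) (t1 / 2).
have t_gt0 : 0 < t by rewrite lt_min !divr_gt0.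
have tt0 : t <= t0 / 2 by rewrite /t ge_min lexx.
have tt1 : t <= t1 / 2 by rewrite /t ge_min lexx orbT.
have [|A0 A1 B0 B1 lB] := t0P t t_gt0; first lra.
(* As [A t <= 2], the error [A t * de] takes at most [eps * B t / 2], the other half going to
   [eta * B t]. *)
pose de := Num.min eta (eps * B t / 4).
have de0 : 0 < de by rewrite lt_min eta0 divr_gt0// mulr_gt0.
have dee : de <= eta by rewrite /de ge_min lexx.
have deB : de <= eps * B t / 4 by rewrite /de ge_min lexx orbT.
exists t, de; split => //; first lra.
move=> a b r0 r1 fy cab ha hb hr Kfy; split.
  have ha' : a ^+ 2 / theta <= A t * (r0 ^+ 2 / theta) + 2 * B t * (`|f0 - K| / theta).
    rewrite ler_pdivrMr//; apply: le_trans ha _.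
    have -> : (A t * (r0 ^+ 2 / theta) + 2 * B t * (`|f0 - K| / theta)) * theta =
      A t * r0 ^+ 2 + 2 * B t * `|f0 - K| by field; rewrite gt_eqF.
    by rewrite lerD2l ler_pM2l ?mulr_gt0//; have := ler_norm (f0 - K); lra.
  have hb' : b ^+ 2 / (1 - theta) <=
      A t * (r1 ^+ 2 / (1 - theta)) + 2 * B t * (`|f1 - K| / (1 - theta)).
    rewrite ler_pdivrMr//; apply: le_trans hb _.
    have -> : (A t * (r1 ^+ 2 / (1 - theta)) + 2 * B t * (`|f1 - K| / (1 - theta))) * (1 - theta) =
      A t * r1 ^+ 2 + 2 * B t * `|f1 - K| by field; rewrite gt_eqF.
    by rewrite lerD2l ler_pM2l ?mulr_gt0//; have := ler_norm (f1 - K); lra.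
  have hr' : r0 ^+ 2 / theta + r1 ^+ 2 / (1 - theta) <= c ^+ 2 * (1 + eta).
    have tt : 0 < theta * (1 - theta) by rewrite mulr_gt0.
    rewrite -(ler_pM2l tt).
    have -> : theta * (1 - theta) * (r0 ^+ 2 / theta + r1 ^+ 2 / (1 - theta)) =
      (1 - theta) * r0 ^+ 2 + theta * r1 ^+ 2 by field; rewrite !gt_eqF.
    apply: le_trans hr _.
    by rewrite [leRHS]mulrA ler_pM2l ?mulr_gt0//; lra.
  have h1 : A t * (r0 ^+ 2 / theta + r1 ^+ 2 / (1 - theta)) <= (1 + eta) * (c ^+ 2 * (1 + eta)).
    apply: ler_pM => //; apply: addr_ge0; apply: divr_ge0; rewrite ?sqr_ge0 //; lra.
  have h2 : 2 * B t * P <= 2 * eta * P by rewrite ler_wpM2r//; lra.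
  have h3 : (1 + eta) * (c ^+ 2 * (1 + eta)) <= c ^+ 2 * (1 + 3 * eta).
    have -> : (1 + eta) * (c ^+ 2 * (1 + eta)) = c ^+ 2 * (1 + 2 * eta + eta * eta) by ring.
    rewrite ler_pM2l//; have := ler_piMr (ltW eta0) eta1. lra.
  have hP : 2 * B t * P = 2 * B t * (`|f0 - K| / theta) + 2 * B t * (`|f1 - K| / (1 - theta)).
    by rewrite /P mulrDr.
  rewrite -/kap; lra.
have t01 : 0 <= theta <= 1 by lra.
apply: le_trans (potential_bound t01 (ltW c0) cab A0 B0 ha hb hr) _.
rewrite lerD2l lerN2.
have -> : (lambda - eps) / 2 * theta * (1 - theta) * c ^+ 2 =
  (lambda - eps) / 2 * (theta * (1 - theta) * c ^+ 2) by ring.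
rewrite ler_pM2r ?mulr_gt0// ler_pM2r// ler_pdivlMr//.
have : A t * de <= 2 * de by rewrite ler_pM2r//; lra.
have : eta * B t <= eps / 2 * B t by rewrite ler_pM2r.
lra.
Qed.

(** The attainable ratios contain 0 and are stable under [theta |-> 1 - theta] and
    [theta |-> theta / 2], hence are dense in [[0, 1]]. Linear bounds on the distances, rather than
    quadratic ones, compose through the triangle inequality. *)
Lemma approx_length_theta (R : realType) (X : metricType R) (D : set X) :
  approx_length_subset (@mdist R X) D ->
  forall theta eta : R, 0 <= theta <= 1 -> 0 < eta ->
  forall x0 x1, D x0 -> D x1 -> exists x, [/\ D x,
    mdist x0 x <= (theta + eta) * mdist x0 x1 &
    mdist x x1 <= (1 - theta + eta) * mdist x0 x1].
Proof.
move=> alD.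
have mid (eta : R) x0 x1 : 0 < eta -> D x0 -> D x1 -> exists x, [/\ D x,
    mdist x0 x <= (2^-1 + eta) * mdist x0 x1 & mdist x x1 <= (2^-1 + eta) * mdist x0 x1].
  move=> eta0 D0 D1; pose e := Num.min eta 2^-1.
  have e0 : 0 < e by rewrite lt_min eta0 invr_gt0 ltr0n.
  have ee : e <= eta by rewrite /e ge_min lexx.
  have e2 : e <= 2^-1 by rewrite /e ge_min lexx orbT.
  have [|x Dx] := alD _ _ D0 D1 e; first by rewrite e0/=; lra.
  rewrite /midpoint /intermediate.
  have := metric_triangle x0 x x1; have := mdist_ge0 x0 x; have := mdist_ge0 x x1.
  have := mdist_ge0 x0 x1.
  set a := mdist x0 x; set b := mdist x x1; set d := mdist x0 x1 => d0 b0 a0 dab H.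
  (* The identity [2 (a^2 + b^2) = (a + b)^2 + (a - b)^2] turns this into linear bounds on [a - b]
     and [a + b]. *)
  have sq : 2 * (a ^+ 2 + b ^+ 2) <= d ^+ 2 * (1 + e ^+ 2 / 4).
    have -> : d ^+ 2 * (1 + e ^+ 2 / 4) = d ^+ 2 * (1 + e ^+ 2 * 2^-1 * (1 - 2^-1)) by field.
    by apply: le_trans H; rewrite le_eqVlt; apply/orP; left; apply/eqP; field.
  have d2 : d ^+ 2 <= (a + b) ^+ 2 by rewrite lerXn2r ?nnegrE//; lra.
  have ed0 : 0 <= e * d by rewrite mulr_ge0// ltW.
  have ab : `|a - b| <= d * e / 2.
    rewrite -[leRHS]ger0_norm; last by rewrite divr_ge0// mulr_ge0// ltW.
    rewrite -ler_sqr ?nnegrE// !real_normK ?num_real//.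
    have -> : (a - b) ^+ 2 = 2 * (a ^+ 2 + b ^+ 2) - (a + b) ^+ 2 by ring.
    have -> : (d * e / 2) ^+ 2 = d ^+ 2 * (e ^+ 2 / 4) by field.
    lra.
  have apb : a + b <= d * (1 + e).
    rewrite -ler_sqr ?nnegrE//; [|lra|by rewrite mulr_ge0//; lra].
    have -> : (a + b) ^+ 2 = 2 * (a ^+ 2 + b ^+ 2) - (a - b) ^+ 2 by ring.
    have -> : (d * (1 + e)) ^+ 2 =
      d ^+ 2 * (1 + e ^+ 2 / 4) + d ^+ 2 * (2 * e + 3 / 4 * e ^+ 2) by field.
    have h1 : 0 <= (a - b) ^+ 2 by exact: sqr_ge0.
    have h2 : 0 <= d ^+ 2 * (2 * e + 3 / 4 * e ^+ 2).
      by apply: mulr_ge0; [exact: sqr_ge0|have := sqr_ge0 e; lra].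
    lra.
  have de : e * d <= eta * d by rewrite ler_wpM2r.
  move: ab; rewrite ler_norml => /andP[ab1 ab2].
  by exists x; split => //; rewrite -/a -/b -/d; lra.
pose P (theta : R) := forall eta : R, 0 < eta -> forall x0 x1, D x0 -> D x1 ->
  exists x, [/\ D x, mdist x0 x <= (theta + eta) * mdist x0 x1 &
    mdist x x1 <= (1 - theta + eta) * mdist x0 x1].
have P0 : P 0.
  move=> eta eta0 x0 x1 D0 _; exists x0; split => //.
    by rewrite mdistxx mulr_ge0 ?mdist_ge0//; lra.
  by rewrite ler_peMl ?mdist_ge0//; lra.
have PC theta : P theta -> P (1 - theta).
  move=> Pt eta eta0 x0 x1 D0 D1; have [x [Dx h1 h2]] := Pt _ eta0 _ _ D1 D0.
  exists x; rewrite metric_sym (metric_sym x x1) (metric_sym x0 x1); split => //.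
  by have -> : 1 - (1 - theta) + eta = theta + eta by ring.
have Phalf theta : 0 <= theta <= 1 -> P theta -> P (theta / 2).
  move=> /andP[t0 t1] Pt eta eta0 x0 x1 D0 D1.
  pose e := Num.min (eta / 4) 1.
  have e0 : 0 < e by rewrite lt_min ltr01 divr_gt0.
  have e1 : e <= 1 by rewrite /e ge_min lexx orbT.
  have ee : e <= eta / 4 by rewrite /e ge_min lexx.
  have [m [Dm m1 m2]] := mid _ _ _ e0 D0 D1.
  have [x [Dx h1 h2]] := Pt _ e0 _ _ D0 Dm.
  have d0 := mdist_ge0 x0 x1.
  have te : theta * e <= e by rewrite ler_piMl// ltW.
  have te0 : 0 <= theta * e by rewrite mulr_ge0// ltW.
  have e2 : e * e <= e by rewrite ler_piMl// ltW.
  exists x; split => //.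
    apply: le_trans h1 _; apply: le_trans (ler_wpM2l _ m1) _; first lra.
    rewrite mulrA ler_wpM2r//; lra.
  apply: le_trans (metric_triangle _ m _) _.
  have h3 : (1 - theta + e) * mdist x0 m <= (1 - theta + e) * ((2^-1 + e) * mdist x0 x1).
    by rewrite ler_wpM2l//; lra.
  apply: le_trans (lerD (le_trans h2 h3) m2) _.
  by rewrite mulrA -mulrDl ler_wpM2r//; lra.
(* Induction along the tent map: [2 * theta] or [2 * (1 - theta)] is approximated first, and halving
   then halves the error. *)
have approx n (theta : R) : 0 <= theta <= 1 ->
    exists t, [/\ 0 <= t <= 1, P t & `|theta - t| <= 2 ^- n].
  elim: n theta => [|n IH] theta /andP[t0 t1].
    by exists 0; split => //; rewrite ?lexx ?ler01// subr0 ger0_norm// expr0 invr1.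
  have -> : 2 ^- n.+1 = 2 ^- n / 2 :> R by rewrite exprS invfM mulrC.
  have [th|th] := leP theta 2^-1.
    have [|t [t01 Pt]] := IH (2 * theta); first by apply/andP; split; lra.
    rewrite ler_norml => tt.
    by exists (t / 2); split; [lra|exact: Phalf|rewrite ler_norml; lra].
  have [|t [t01 Pt]] := IH (2 * (1 - theta)); first by apply/andP; split; lra.
  rewrite ler_norml => tt.
  by exists (1 - t / 2); split; [lra|exact/PC/Phalf|rewrite ler_norml; lra].
move=> theta eta t01 eta0 x0 x1 D0 D1.
have [n nP] : exists n : nat, 2 ^- n <= eta / 2 :> R.
  exists (Num.bound (2 / eta)).
  have e20 : 0 <= 2 / eta by rewrite divr_ge0// ltW.
  have := archi_boundP e20; set n := Num.bound _ => nb.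
  have n2 : n%:R <= 2 ^+ n :> R by rewrite -natrX ler_nat ltnW// ltn_expl.
  rewrite -[leRHS]invrK lef_pV2 ?posrE ?exprn_gt0 ?invr_gt0 ?divr_gt0//.
  by rewrite invf_div (le_trans (ltW nb)).
have [t [_ Pt tt]] := approx n _ t01.
have e2 : 0 < eta / 2 by rewrite divr_gt0.
have [x [Dx h1 h2]] := Pt _ e2 _ _ D0 D1.
move: (le_trans tt nP); rewrite ler_norml => /andP[t1 t2].
have d0 := mdist_ge0 x0 x1.
exists x; split => //.
  by apply: le_trans h1 _; rewrite ler_wpM2r//; lra.
by apply: le_trans h2 _; rewrite ler_wpM2r//; lra.
Qed.

Section EVI_convexity.
Context (R : realType) (X : metricType R) (phi : X -> \bar R) (lambda : R).
Context (D : set X) (S : R -> X -> X).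
Hypothesis phi_gtNy : forall x, (-oo < phi x)%E.
Hypothesis phi_lsc : lower_semicontinuous phi.
Hypothesis S_flow : EVI_flow phi lambda D S.

Local Notation f x := (fine (phi x)).
Local Notation A t := (expR (- (lambda * t))).
Local Notation B t := (expR (- (lambda * t)) * Elambda lambda t).

Lemma EVI_flow_Dom x (t : R) : D x -> 0 < t -> Dom phi (S t x).
Proof. by move=> Dx t0; exact: (EVI_dom (EVI_flow_solution S_flow Dx) t0). Qed.

Lemma EVI_flow_sq x v (t : R) : D x -> 0 < t -> Dom phi v ->
  mdist v (S t x) ^+ 2 <= A t * mdist v x ^+ 2 + 2 * B t * (f v - f (S t x)).
Proof.
move=> Dx t0 dv; have := EVI_flow_integral phi_gtNy phi_lsc S_flow Dx t0 dv.
rewrite (metric_sym v) (metric_sym v x).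
have e0 := expR_gt0 (lambda * t); have := expRxMexpNx_1 (lambda * t).
set E := expR (lambda * t) in e0 *; set N := expR (- _) => EN H.
rewrite -(ler_pM2l e0).
have -> : E * (N * mdist x v ^+ 2 + 2 * (N * Elambda lambda t) * (f v - f (S t x))) =
  (E * N) * (mdist x v ^+ 2 + 2 * Elambda lambda t * (f v - f (S t x))) by ring.
rewrite EN; lra.
Qed.

Lemma intermediate_sum (theta eps : R) x0 x1 x : 0 < theta < 1 ->
  intermediate (@mdist R X) theta eps x0 x1 x ->
  (1 - theta) * mdist x0 x ^+ 2 + theta * mdist x1 x ^+ 2 <=
  theta * (1 - theta) * mdist x0 x1 ^+ 2 * (1 + eps ^+ 2 * theta * (1 - theta)).
Proof.
move=> /andP[t0 t1]; rewrite /intermediate => H.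
have t1' : 0 < 1 - theta by lra.
have tt : 0 < theta * (1 - theta) by rewrite mulr_gt0.
move: H; rewrite -(ler_pM2l tt) mulrA (metric_sym x x1).
have -> // : theta * (1 - theta) * (mdist x0 x ^+ 2 / theta + mdist x1 x ^+ 2 / (1 - theta)) =
  (1 - theta) * mdist x0 x ^+ 2 + theta * mdist x1 x ^+ 2 by field; rewrite !gt_eqF.
Qed.

Lemma flow_potential_bound x0 x1 x (theta eps t : R) :
  Dom phi x0 -> Dom phi x1 -> D x -> 0 < theta < 1 -> 0 < t ->
  intermediate (@mdist R X) theta eps x0 x1 x ->
  f (S t x) <= (1 - theta) * f x0 + theta * f x1
    - 2^-1 * (lambda - eps ^+ 2 / Elambda lambda t) * theta * (1 - theta) * mdist x0 x1 ^+ 2.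
Proof.
move=> d0 d1 Dx th t0 /(intermediate_sum th) H.
have E0 := Elambda_gt0 lambda t0.
have A0 := expR_gt0 (- (lambda * t)).
have B0 : 0 < B t by rewrite mulr_gt0.
have th' : 0 <= theta <= 1 by move: th; lra.
have tri : mdist x0 x1 <= mdist x0 (S t x) + mdist x1 (S t x).
  by rewrite (metric_sym x1); exact: metric_triangle.
apply: le_trans (potential_bound th' (mdist_ge0 _ _) tri (ltW A0) B0
  (EVI_flow_sq Dx t0 d0) (EVI_flow_sq Dx t0 d1) H) _.
rewrite lerD2l lerN2.
have -> : 2^-1 * (lambda - eps ^+ 2 / Elambda lambda t) * theta * (1 - theta) * mdist x0 x1 ^+ 2 =
  (lambda - eps ^+ 2 / Elambda lambda t) / 2 * (theta * (1 - theta) * mdist x0 x1 ^+ 2) by ring.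
have [th0 th1'] := andP th; have th1 : 0 < 1 - theta by lra.
apply: ler_wpM2r.
  by apply: mulr_ge0; [apply: mulr_ge0; exact: ltW|exact: sqr_ge0].
rewrite ler_pM2r//.
have lE := mul_Elambda lambda (ltW t0).
have EN : (1 + lambda * Elambda lambda t) * A t = 1.
  by rewrite lE subrKC expRxMexpNx_1.
pose kap := eps ^+ 2 * theta * (1 - theta).
(* Since [1 - A t = lambda * B t], the constant obtained is [lambda - kap / Elambda lambda t]; the
   claimed one follows from [theta * (1 - theta) <= 1]. *)
have -> : 1 - A t * (1 + eps ^+ 2 * theta * (1 - theta)) =
    (lambda - kap / Elambda lambda t) * B t.
  rewrite -{1}EN -/kap; set N := expR _; field; exact: lt0r_neq0.
rewrite mulfK; last exact: lt0r_neq0.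
rewrite lerD2l lerN2 ler_pM2r ?invr_gt0// /kap -mulrA ler_piMr ?sqr_ge0//.
by have := mulr_ile1 (ltW th0) (ltW th1); lra.
Qed.

(** Integrated EVI from [x0] over a unit of time, without its nonnegative term in [S 1 x0], bounds
    [phi] below by a quadratic. *)
Lemma flow_lower_bound x0 : D x0 ->
  exists C K : R, 0 <= C /\ forall v, Dom phi v -> K - C * mdist x0 v ^+ 2 <= f v.
Proof.
move=> Dx0; have E0 := Elambda_gt0 lambda ltr01.
exists (2 * Elambda lambda 1)^-1, (f (S 1 x0)); split.
  by rewrite invr_ge0 mulr_ge0// ltW.
move=> v dv; have := EVI_flow_integral phi_gtNy phi_lsc S_flow Dx0 ltr01 dv.
have h : 0 <= expR (lambda * 1) * mdist (S 1 x0) v ^+ 2.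
  by rewrite mulr_ge0 ?sqr_ge0// ltW// expR_gt0.
move=> H; rewrite lerBlDl -lerBlDr mulrC ler_pdivlMr ?mulr_gt0//.
lra.
Qed.

(** EVI bounds [d^2(x0, S_t x)] through the energy of [S_t x], itself bounded below by
    [K0 - C d^2(x0, S_t x)]. For small [t] the quadratic term is absorbed: [8 * C * t <= 1] makes it
    at most [a2 / 2]. *)
Lemma flow_lower_bound_near x0 (M : R) : D x0 -> Dom phi x0 -> 0 <= M ->
  exists2 t0 : R, 0 < t0 & exists K : R, forall t x, 0 < t -> t < t0 -> D x ->
    mdist x0 x <= M -> K <= f (S t x).
Proof.
move=> Dx0 d0 M0; have [C [K0 [C0 CK]]] := flow_lower_bound Dx0.
have Alim : A t @[t --> 0^'+] --> (1 : R).
  by have := expR_scale_cvg1 (- lambda); under eq_fun do rewrite mulNr.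
have : \forall t \near 0^'+, [/\ A t <= 2, expR (`|- lambda| * t) <= 2, t <= 1 &
    t * (8 * C + 1) <= 1].
  have C1 : 0 < 8 * C + 1 by lra.
  near=> t; split.
  - by near: t; apply: cvgr_le Alim _ _; lra.
  - by near: t; apply: cvgr_le (expR_scale_cvg1 _) _ _; lra.
  - by near: t; exact: nbhs_right_le.
  - by rewrite -ler_pdivlMr//; near: t; apply: nbhs_right_le; rewrite divr_gt0.
case=> t0 /= t00 t0P; exists t0 => //.
pose Q := 4 * M ^+ 2 + 8 * `|f x0 - K0|.
exists (K0 - C * Q) => t x t_gt0 tt0 Dx xM.
have [||A2 E2 t1 tC] := t0P t; [by rewrite /= sub0r normrN gtr0_norm|by []|].
have dy := EVI_flow_Dom Dx t_gt0.
have H := EVI_flow_sq Dx t_gt0 d0.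
have Hy := CK _ dy.
set y := S t x in dy H Hy *; set a2 := mdist x0 y ^+ 2 in H Hy.
have a20 : 0 <= a2 by exact: sqr_ge0.
have B0 : 0 < B t by rewrite mulr_gt0 ?expR_gt0 ?Elambda_gt0.
have Bt : B t <= 2 * t.
  rewrite (expRN_Elambda _ (ltW t_gt0)); apply: le_trans (Elambda_le _ (ltW t_gt0)) _.
  by rewrite mulrC ler_pM2r.
have aM : A t * mdist x0 x ^+ 2 <= 2 * M ^+ 2.
  apply: ler_pM; [exact/ltW/expR_gt0|exact: sqr_ge0|exact: A2|].
  by rewrite lerXn2r ?nnegrE ?mdist_ge0.
have h1 : 2 * B t * (f x0 - f y) <= 2 * B t * (`|f x0 - K0| + C * a2).
  have B20 : 0 < 2 * B t by lra.
  by rewrite (ler_pM2l B20); have := ler_norm (f x0 - K0); lra.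
have h2 : 2 * B t * (`|f x0 - K0| + C * a2) <= 4 * t * (`|f x0 - K0| + C * a2).
  by rewrite ler_wpM2r//; [rewrite addr_ge0// mulr_ge0|lra].
have h3 : 4 * t * `|f x0 - K0| <= 4 * `|f x0 - K0|.
  by rewrite ler_wpM2r//; lra.
have h4 : 4 * t * (C * a2) <= a2 / 2.
  have -> : 4 * t * (C * a2) = (t * (8 * C)) * a2 / 2 by field.
  by rewrite ler_pM2r// ler_piMl//; lra.
have aQ : a2 <= Q by rewrite /Q; lra.
apply: le_trans Hy; rewrite lerD2l lerN2 ler_wpM2l//.
Unshelve. all: by end_near. Qed.

End EVI_convexity.

Section EVI_convexity_ereal.
Context (R : realType) (X : metricType R) (phi : X -> \bar R) (lambda : R).
Context (D : set X) (S : R -> X -> X).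
Hypothesis phi_gtNy : forall x, (-oo < phi x)%E.
Hypothesis phi_lsc : lower_semicontinuous phi.
Hypothesis S_flow : EVI_flow phi lambda D S.

Local Notation f x := (fine (phi x)).
Local Notation A t := (expR (- (lambda * t))).
Local Notation B t := (expR (- (lambda * t)) * Elambda lambda t).

Lemma convex_comb_fine (theta r : R) x0 x1 : Dom phi x0 -> Dom phi x1 ->
  ((1 - theta)%:E * phi x0 + theta%:E * phi x1 - r%:E =
   ((1 - theta) * f x0 + theta * f x1 - r)%:E)%E.
Proof. by move=> d0 d1; rewrite {1}(Dom_fine phi_gtNy d0) {1}(Dom_fine phi_gtNy d1). Qed.

Lemma intermediate_id (dist : X -> X -> R) (theta eps : R) x :
  dist x x = 0 -> intermediate dist theta eps x x x.
Proof. by move=> xx; rewrite /intermediate xx expr0n/= !mul0r addr0. Qed.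

Lemma approx_convex_length_subset :
  approx_length_subset (@mdist R X) D -> approx_convex (@mdist R X) phi lambda D.
Proof.
move=> alD x0 x1 [D0 d0] [D1 d1] theta eps th /andP[eps0 _].
have [c0|c0] := eqVneq (mdist x0 x1) 0.
  rewrite -(mdist_positivity _ _ c0).
  exists x0; split => //; first by apply: intermediate_id; rewrite mdistxx.
  rewrite convex_comb_fine// {1}(Dom_fine phi_gtNy d0) lee_fin mdistxx expr0n/= mulr0.
  by lra.
have c_gt0 : 0 < mdist x0 x1 by rewrite lt_neqAle eq_sym c0 mdist_ge0.
set c := mdist x0 x1 in c_gt0 *.
have c2 : 0 <= 2 * c by lra.
(* [K] is fixed before the time and the intermediate point; the radius [2 * c] allows for every
   point chosen later. *)
have [t1 t10 [K t1K]] := flow_lower_bound_near phi_gtNy phi_lsc S_flow D0 d0 c2.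
have AB (eta : R) : 0 < eta -> exists2 t0, 0 < t0 & forall t, 0 < t -> t < t0 ->
    [/\ 0 <= A t, A t <= 1 + eta, 0 < B t, B t <= eta & (lambda - eta) * B t <= 1 - A t].
  move=> eta0.
  have Alim : A t @[t --> 0^'+] --> (1 : R).
    by have := expR_scale_cvg1 (- lambda); under eq_fun do rewrite mulNr.
  have : \forall t \near 0^'+, [/\ A t <= 1 + eta, expR (`|- lambda| * t) <= 2 & t <= eta / 2].
    near=> t; split.
    - by near: t; apply: cvgr_le Alim _ _; lra.
    - by near: t; apply: cvgr_le (expR_scale_cvg1 _) _ _; lra.
    - by near: t; apply: nbhs_right_le; rewrite divr_gt0.
  case=> t0 /= t00 t0P; exists t0 => // t t_gt0 tt0.
  have [||A1 E1 teta] := t0P t; [by rewrite /= sub0r normrN gtr0_norm|by []|].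
  have B0 : 0 < B t by rewrite mulr_gt0 ?expR_gt0 ?Elambda_gt0.
  split => //.
    rewrite (expRN_Elambda _ (ltW t_gt0)); apply: le_trans (Elambda_le _ (ltW t_gt0)) _.
    have : t * expR (`|- lambda| * t) <= t * 2 by rewrite ler_pM2l.
    lra.
  have -> : 1 - A t = lambda * B t.
    have := mul_Elambda lambda (ltW t_gt0); have := expRxMexpNx_1 (lambda * t).
    by move=> EN lE; rewrite mulrCA lE mulrBr mulr1 [_ * expR (lambda * t)]mulrC EN.
  by rewrite ler_pM2r//; lra.
have [t [de [t_gt0 tt1 de0 main]]] := @approx_convex_params R lambda theta eps c (f x0) (f x1) K t1
  (fun t => A t) (fun t => B t) th eps0 c_gt0 t10 AB.
have [th0 th1'] := andP th; have th1 : 0 < 1 - theta by lra.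
have tt0 : 0 < theta * (1 - theta) by rewrite mulr_gt0.
(* The weighted sum of squares exceeds its ideal value by [4 * theta * (1 - theta) * eta + eta^2],
   at most [5 * eta], times [c ^+ 2]. *)
pose eta := Num.min 1 (theta * (1 - theta) * de / 5).
have eta0 : 0 < eta by rewrite lt_min ltr01 divr_gt0// mulr_gt0.
have eta1 : eta <= 1 by rewrite /eta ge_min lexx.
have etade : eta <= theta * (1 - theta) * de / 5 by rewrite /eta ge_min lexx orbT.
have th01 : 0 <= theta <= 1 by lra.
have [x [Dx xx0 xx1]] := approx_length_theta alD th01 eta0 D0 D1.
have dy := EVI_flow_Dom S_flow Dx t_gt0.
have [|||||int fy] := main (mdist x0 (S t x)) (mdist x1 (S t x))
  (mdist x0 x) (mdist x1 x) (f (S t x)).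
- by rewrite (metric_sym x1); exact: metric_triangle.
- exact: (EVI_flow_sq phi_gtNy phi_lsc S_flow).
- exact: (EVI_flow_sq phi_gtNy phi_lsc S_flow).
- rewrite -/c in xx0 xx1; rewrite (metric_sym x1).
  have a2 : mdist x0 x ^+ 2 <= (theta + eta) ^+ 2 * c ^+ 2.
    by rewrite -exprMn lerXn2r ?nnegrE ?mdist_ge0 ?mulr_ge0//; lra.
  have b2 : mdist x x1 ^+ 2 <= (1 - theta + eta) ^+ 2 * c ^+ 2.
    by rewrite -exprMn lerXn2r ?nnegrE ?mdist_ge0 ?mulr_ge0//; lra.
  have a2' := ler_wpM2l (ltW th1) a2; have b2' := ler_wpM2l (ltW th0) b2.
  apply: le_trans (lerD a2' b2') _.
  have -> : (1 - theta) * ((theta + eta) ^+ 2 * c ^+ 2) +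
      theta * ((1 - theta + eta) ^+ 2 * c ^+ 2) =
    (theta * (1 - theta) + (4 * (theta * (1 - theta)) * eta + eta * eta)) * c ^+ 2 by ring.
  have -> : theta * (1 - theta) * c ^+ 2 * (1 + de) =
    (theta * (1 - theta) + theta * (1 - theta) * de) * c ^+ 2 by ring.
  rewrite ler_pM2r ?exprn_gt0// lerD2l.
  have e2 : eta * eta <= eta by rewrite ler_piMl// ltW.
  have : theta * (1 - theta) * eta <= eta.
    by apply: ler_piMl; [exact: ltW|apply: mulr_ile1; lra].
  lra.
- apply: t1K => //; apply: le_trans xx0 _; rewrite ler_wpM2r ?mdist_ge0//; lra.
exists (S t x); split.
- exact: (EVI_flow_stable S_flow (ltW t_gt0)).
- by rewrite /intermediate (metric_sym _ x1).
- by rewrite convex_comb_fine// {1}(Dom_fine phi_gtNy dy) lee_fin.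
Unshelve. all: by end_near. Qed.

Lemma convex_along_Geo x0 x1 x : D x0 -> Dom phi x0 -> D x1 -> Dom phi x1 ->
  Geo D x0 x1 x -> convex_along phi lambda x0 x1 x.
Proof.
move=> D0 d0 D1 d1 [Dx x0E x1E geo] t /andP[t0 t1].
rewrite convex_comb_fine//.
have [->|tn0] := eqVneq t 0.
  by rewrite x0E {1}(Dom_fine phi_gtNy d0) lee_fin !(mulr0, mul0r, subr0, mul1r, addr0).
have [->|tn1] := eqVneq t 1.
  by rewrite x1E {1}(Dom_fine phi_gtNy d1) lee_fin !(subrr, mulr0, mul0r, subr0, mul1r, add0r).
have th : 0 < t < 1 by rewrite !lt_neqAle eq_sym tn0 t0 tn1.
have Dxt : D (x t) by apply: Dx; rewrite t0.
(* A point of a geodesic is intermediate with accuracy 0, so the bound along the flow does not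
   depend on the time. *)
have int : intermediate (@mdist R X) t 0 x0 x1 (x t).
  rewrite /intermediate -{1}x0E -{1}x1E !geo ?lexx ?ler01 ?t0 ?t1//.
  rewrite sub0r normrN (ger0_norm t0) distrC ger0_norm ?subr_ge0// expr0n/= !mul0r addr0 mulr1.
  have [th0 th1'] := andP th; have th1 : 1 - t != 0 by rewrite gt_eqF// subr_gt0.
  rewrite le_eqVlt; apply/orP; left; apply/eqP; field.
  by rewrite th1 tn0.
(* The finiteness of [phi (x t)] is part of the claim: lower semicontinuity is applied to a strict
   inequality in the extended reals. *)
rewrite leNgt; apply/negP => /phi_lsc[V Vx VP].
have [s [s0 Vs]] : exists s, 0 < s /\ V (S s (x t)).
  have : \forall s \near 0^'+, 0 < s /\ V (S s (x t)).
    near=> s; split; first by near: s; exact: nbhs_right_gt.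
    by near: s; exact: (EVI_flow_lim S_flow Dxt).
  by move=> /filter_ex[s ?]; exists s.
have := VP _ Vs; rewrite (Dom_fine phi_gtNy (EVI_flow_Dom S_flow Dxt s0)) lte_fin.
have := flow_potential_bound phi_gtNy phi_lsc S_flow d0 d1 Dxt th s0 int.
rewrite expr0n/= mul0r subr0 => h1 h2.
by move: (lt_le_trans h2 h1); rewrite mulrC [X in _ - X]mulrC; lra.
Unshelve. all: by end_near. Qed.

End EVI_convexity_ereal.

(** * The flow and the length distance *)

(** Chains short intervals by steps of [r / 2], so that estimates valid only for small time
    increments extend to the whole interval. *)
Lemma local_to_global (R : realType) (a b r : R) (P : R -> R -> Prop) : 0 < r ->
  (forall p q s, P p q -> P q s -> P p s) ->
  (forall p q, a <= p -> p < q -> q <= b -> q - p < r -> P p q) ->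
  forall p q, a <= p -> p < q -> q <= b -> P p q.
Proof.
move=> r0 trans local.
have H (n : nat) : forall p q, a <= p -> p < q -> q <= b -> q - p < n%:R * (r / 2) -> P p q.
  elim: n => [|n IH] p q ap pq qb; first by rewrite mul0r => ?; lra.
  rewrite -natr1 mulrDl mul1r => pqn.
  have [qpr|rqp] := ltP (q - p) r; first exact: local.
  by apply: (trans p (q - r / 2)); [apply: IH|apply: local]; lra.
move=> p q ap pq qb.
have r20 : 0 < r / 2 by rewrite divr_gt0.
apply: (H (Num.bound ((q - p) / (r / 2)))) => //.
rewrite -ltr_pdivrMr//; apply: archi_boundP.
by rewrite divr_ge0 ?ltW// subr_gt0.
Qed.

Lemma expR_le_quadratic (R : realType) (u : R) : u <= 2^-1 -> expR u <= 1 + u + 2 * u ^+ 2.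
Proof.
move=> u2; have h := expR_ge1Dx (- u).
have h1 : (1 - u) * expR u <= 1.
  by rewrite -[leRHS](expRxMexpNx_1 u) mulrC ler_pM2l ?expR_gt0.
have u1 : 0 < 1 - u by lra.
rewrite -(ler_pM2l u1); apply: le_trans h1 _; rewrite -subr_ge0.
have -> : (1 - u) * (1 + u + 2 * u ^+ 2) - 1 = u ^+ 2 * (1 - 2 * u) by ring.
by rewrite mulr_ge0 ?sqr_ge0//; lra.
Qed.

Lemma AMGM_le (R : realType) (d P Q eta : R) : 0 < eta -> 0 <= d -> 0 <= P -> 0 <= Q ->
  d ^+ 2 <= P * Q -> d <= (eta * P + Q / eta) / 2.
Proof.
move=> e0 d0 P0 Q0 H.
have s0 : 0 <= (eta * P + Q / eta) / 2.
  by rewrite divr_ge0// addr_ge0//; [apply: mulr_ge0|apply: divr_ge0] => //; exact: ltW.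
rewrite -ler_sqr ?nnegrE//; apply: le_trans H _; rewrite -subr_ge0.
have -> : ((eta * P + Q / eta) / 2) ^+ 2 - P * Q = ((eta * P - Q / eta) / 2) ^+ 2.
  by field; rewrite gt_eqF.
exact: sqr_ge0.
Qed.

(* AM-GM turns the energy bound into a Lipschitz bound for the new time
   [(eta * (k * s) + G s / eta) / 2], with [eta] chosen optimally. *)
Lemma lip_path_energy (R : realType) (X : metricType R) (t k r : R) (y : R -> X) (G : R -> R) :
  0 < t -> 0 < k -> 0 < r ->
  (forall p q, 0 <= p -> p < q -> q <= t -> q - p < r ->
     0 <= G q - G p /\ mdist (y p) (y q) ^+ 2 <= k * (q - p) * (G q - G p)) ->
  0 <= k * t * (G t - G 0) /\
  forall mu, 0 < mu -> k * t * (G t - G 0) <= mu ^+ 2 -> lip_path mu (y 0) (y t).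
Proof.
move=> t0 k0 r0 loc.
have Gmono p q : 0 <= p -> p < q -> q <= t -> G p <= G q.
  apply: (local_to_global (P := fun p q => G p <= G q) r0) => [|p' q' p'0 pq qt pqr].
    by move=> ? ? ?; exact: le_trans.
  by rewrite -subr_ge0; exact: (loc _ _ p'0 pq qt pqr).1.
have Gle p q : 0 <= p -> p <= q -> q <= t -> G p <= G q.
  by move=> p0; rewrite le_eqVlt => /predU1P[->//|pq] qt; exact: Gmono.
have g0 : 0 <= G t - G 0 by rewrite subr_ge0 Gle// ltW.
have kt0 : 0 < k * t by rewrite mulr_gt0.
split; first by rewrite mulr_ge0// ltW.
(* With this [eta] the linear part of the new time is exactly [mu] and the part from [G] at most
   [mu]; [T] is half of their sum. *)
move=> mu mu0 tot; pose eta := mu / (k * t).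
have eta0 : 0 < eta by rewrite divr_gt0.
pose T s := (eta * (k * s) + G s / eta) / 2.
have TB p q : T q - T p = (eta * (k * (q - p)) + (G q - G p) / eta) / 2.
  by rewrite /T; field; rewrite gt_eqF.
have Tinc p q : 0 <= p -> p < q -> q <= t -> T p < T q.
  move=> p0 pq qt; rewrite -subr_gt0 TB divr_gt0// ltr_pwDl//.
    by rewrite mulr_gt0// mulr_gt0// subr_gt0.
  by apply: divr_ge0; [rewrite subr_ge0 Gmono|exact: ltW].
have yT p q : 0 <= p -> p < q -> q <= t -> mdist (y p) (y q) <= T q - T p.
  apply: (local_to_global (P := fun p q => mdist (y p) (y q) <= T q - T p) r0).
    by move=> p' q' s h1 h2; have := metric_triangle (y p') (y q') (y s); lra.
  move=> p' q' p'0 pq qt pqr; have [G0 H] := loc _ _ p'0 pq qt pqr.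
  by rewrite TB; apply: AMGM_le; rewrite ?mdist_ge0// mulr_ge0//; lra.
have T01 : T t - T 0 <= mu.
  rewrite TB subr0.
  have -> : eta * (k * t) = mu by rewrite /eta divfK// gt_eqF.
  have : (G t - G 0) / eta <= mu.
    rewrite ler_pdivrMr// /eta mulrA ler_pdivlMr// -expr2.
    by apply: le_trans tot; rewrite mulrC.
  lra.
have T0 : 0 <= T t - T 0 by rewrite subr_ge0 ltW// Tinc.
apply: (lip_path_widen T0 T01).
apply: lip_path_reparam => //; first exact: ltW.
move=> p e /andP[p0 pt] e0.
have den0 : 0 < k * (G t - G 0) + 1 by rewrite ltr_wpDl// mulr_ge0// ltW.
have cont p' q' : 0 <= p' -> p' < q' -> q' <= t -> q' - p' < r ->
    q' - p' < e ^+ 2 / (k * (G t - G 0) + 1) -> mdist (y p') (y q') < e.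
  move=> p'0 pq qt pqr; rewrite ltr_pdivlMr// => pqe.
  rewrite -ltr_sqr ?nnegrE ?mdist_ge0 ?ltW//.
  apply: le_lt_trans (loc _ _ p'0 pq qt pqr).2 _; apply: le_lt_trans pqe.
  rewrite mulrAC mulrC; apply: ler_wpM2l; first lra.
  have : k * (G q' - G p') <= k * (G t - G 0).
    rewrite ler_pM2l//; have := Gle 0 p' (lexx _) p'0; have := Gle q' t; lra.
  lra.
exists (Num.min r (e ^+ 2 / (k * (G t - G 0) + 1))).
  by rewrite lt_min r0 divr_gt0// exprn_gt0.
move=> q /andP[q0 qt]; rewrite lt_min !ltr_norml => /andP[/andP[? ?] /andP[? ?]].
have [pq|qp|->] := ltgtP p q; last by rewrite mdistxx.
- by apply: cont.
- by rewrite metric_sym; apply: cont => //; lra.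
Qed.

Section flow_length.
Context (R : realType) (X : metricType R) (phi : X -> \bar R) (lambda : R).
Context (D : set X) (S : R -> X -> X).
Hypothesis phi_gtNy : forall x, (-oo < phi x)%E.
Hypothesis phi_lsc : lower_semicontinuous phi.
Hypothesis S_flow : EVI_flow phi lambda D S.
Hypothesis DT : forall x, D x.

Local Notation f x := (fine (phi x)).

(* The flow is applied to a curve from [v] to [x] with running time increasing
   from [0] to [t]: the resulting curve [s |-> S s (g (c s / t))] joins [v] to
   [S t x], and its energy is controlled by EVI and contraction. *)
Lemma flow_lip_path x v (c t k : R) : 0 < t -> 2 * `|lambda| * t <= 2^-1 ->
  0 <= c -> lip_path c v x -> Dom phi v -> 0 < k ->
  let L := (1 + k) * ((1 + k) * c ^+ 2 * (1 + k + 8 * lambda ^+ 2 * t ^+ 2 - lambda * t)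
                      + 2 * t * (f v - f (S t x))) in
  0 <= L /\ forall mu, 0 < mu -> L <= mu ^+ 2 -> lip_path mu v (S t x).
Proof.
move=> t0 lt c0 [g [g0 gc gl]] dv k0 L.
pose y s := S s (g (c * s / t)).
have y0 : y 0 = v by rewrite /y mulr0 mul0r g0 (EVI_flow_init S_flow).
have yt : y t = S t x by rewrite /y mulfK ?gt_eqF// gc.
have dy s : 0 <= s -> Dom phi (y s).
  rewrite le_eqVlt => /predU1P[<-|s0]; first by rewrite y0.
  exact: (EVI_flow_Dom S_flow).
(* The increment of [F] on [[p, q]] is [(q - p) (1 + k + 8 lambda^2 t^2 - lambda (p + q))], a
   majorant of the contraction factor [e^(-2 lambda p)] times [q - p]. *)
pose F s := (1 + k + 8 * lambda ^+ 2 * t ^+ 2) * s - lambda * s ^+ 2.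
pose G s := (1 + k) * (c / t) ^+ 2 * F s - 2 * f (y s).
have [r r0 rP] : exists2 r : R, 0 < r & forall h, 0 < h -> h < r ->
    expR (`|lambda| * h) <= 1 + k /\ `|lambda| * h <= k.
  have : \forall h \near 0^'+, expR (`|lambda| * h) <= 1 + k.
    by apply: cvgr_le (expR_scale_cvg1 _) _ _; lra.
  case=> r /= r0 rP; exists r => // h h0 hr.
  have H : expR (`|lambda| * h) <= 1 + k by apply: rP => //=; rewrite sub0r normrN gtr0_norm.
  by split => //; have := expR_ge1Dx (`|lambda| * h); lra.
have -> : L = (1 + k) * t * (G t - G 0).
  by rewrite /L /G y0 yt /F; field; rewrite gt_eqF.
rewrite -y0 -yt; apply: (lip_path_energy (r := r)) => //; first lra.
move=> p q p0 pq qt qpr.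
pose h := q - p.
have h0 : 0 < h by rewrite subr_gt0.
have [hk lhk] := rP h h0 qpr.
have q0 : 0 <= q by lra.
(* The step from [y p] to [y q] goes through [z]: contraction compares [y p] with [z], and EVI from
   [z], tested at [y p], reaches [y q]. *)
pose z := S p (g (c * q / t)).
have yq : y q = S h z.
  by rewrite /z /y -(EVI_flow_semigroup S_flow) ?subrKC// ltW.
have zp : mdist (y p) z ^+ 2 <= expR (- (2 * lambda * p)) * (c * h / t) ^+ 2.
  have := EVI_flow_contraction phi_gtNy phi_lsc S_flow (DT (g (c * p / t))) (DT (g (c * q / t))) p0.
  rewrite -/(y p) -/z; set e := expR (2 * lambda * p) => H.
  have e0 : 0 < e by exact: expR_gt0.
  rewrite -(ler_pM2l e0).
  have -> : e * (expR (- (2 * lambda * p)) * (c * h / t) ^+ 2) = (c * h / t) ^+ 2.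
    by rewrite mulrA expRxMexpNx_1 mul1r.
  apply: le_trans H _.
  rewrite lerXn2r ?nnegrE ?mdist_ge0//.
    by rewrite !mulr_ge0 ?invr_ge0// ltW.
  have -> : c * h / t = c * q / t - c * p / t by rewrite /h; ring.
  apply: gl.
  - by rewrite !mulr_ge0 ?invr_ge0// ltW.
  - by rewrite ler_pM2r ?invr_gt0// ler_wpM2l// ltW.
  - by rewrite ler_pdivrMr// ler_wpM2l.
have H := EVI_flow_sq phi_gtNy phi_lsc S_flow (DT z) h0 (dy _ p0).
rewrite -yq in H.
have E0 := Elambda_gt0 lambda h0.
have Eh : h <= (1 + k) * Elambda lambda h.
  have := Elambda_ge lambda (ltW h0).
  rewrite expRN ler_pdivrMr ?expR_gt0// => /le_trans; apply.
  by rewrite mulrC ler_pM2r.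
have Bh : expR (- (lambda * h)) * Elambda lambda h <= (1 + k) * h.
  rewrite (expRN_Elambda _ (ltW h0)); apply: le_trans (Elambda_le _ (ltW h0)) _.
  by rewrite normrN mulrC ler_pM2r.
set E := Elambda lambda h in E0 Eh Bh H.
set N := expR (- (lambda * h)) in Bh H.
have N0 : 0 < N by exact: expR_gt0.
set De := f (y p) - f (y q) in H.
set dz := mdist (y p) z ^+ 2 in zp H.
set d2 := mdist (y p) (y q) ^+ 2 in H *.
have d20 : 0 <= d2 by exact: sqr_ge0.
(* Factoring out [N * E] shows that the remaining factor is nonnegative, so both factors can be
   majorised separately. *)
have HW : d2 <= N * E * (dz / E + 2 * De).
  apply: le_trans H _; rewrite le_eqVlt; apply/orP; left; apply/eqP.
  by field; rewrite gt_eqF.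
have NE0 : 0 < N * E by rewrite mulr_gt0.
have W0 : 0 <= dz / E + 2 * De.
  by rewrite -(pmulr_rge0 _ NE0); exact: le_trans HW.
(* With [u = -2 lambda p], the quadratic term [2 u^2] is at most [8 lambda^2 t^2], and
   [u = - lambda (p + q) + lambda h], where [lambda h <= k]. *)
have exp_le : expR (- (2 * lambda * p)) <= 1 + k + 8 * lambda ^+ 2 * t ^+ 2 - lambda * (p + q).
  have lp : - lambda * p <= `|lambda| * p.
    by rewrite ler_wpM2r// -normrN ler_norm.
  have lpt : `|lambda| * p <= `|lambda| * t by rewrite ler_wpM2l//; lra.
  have u2 : - (2 * lambda * p) <= 2^-1 by lra.
  apply: le_trans (expR_le_quadratic u2) _.
  have lh : lambda * h <= k by apply: le_trans lhk; rewrite ler_pM2r// ler_norm.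
  have p2 : lambda ^+ 2 * p ^+ 2 <= lambda ^+ 2 * t ^+ 2.
    by rewrite ler_wpM2l ?sqr_ge0// lerXn2r ?nnegrE//; lra.
  rewrite /h in lh.
  have -> : (- (2 * lambda * p)) ^+ 2 = 4 * (lambda ^+ 2 * p ^+ 2) by ring.
  lra.
have WG : dz / E + 2 * De <= G q - G p.
  have -> : G q - G p = (1 + k) * (c / t) ^+ 2 *
      (h * (1 + k + 8 * lambda ^+ 2 * t ^+ 2 - lambda * (p + q))) + 2 * De.
    by rewrite /G /F /De /h; ring.
  rewrite lerD2r ler_pdivrMr//; apply: le_trans zp _.
  have -> : expR (- (2 * lambda * p)) * (c * h / t) ^+ 2 =
    ((c / t) ^+ 2 * h * expR (- (2 * lambda * p))) * h by ring.
  have ct0 : 0 <= (c / t) ^+ 2 by exact: sqr_ge0.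
  have cth : 0 <= (c / t) ^+ 2 * h by rewrite mulr_ge0// ltW.
  have e0 := expR_gt0 (- (2 * lambda * p)).
  set Q := 1 + k + _ - _ in exp_le *.
  have Q0 : 0 <= Q by apply: le_trans exp_le; exact: ltW.
  have -> : (1 + k) * (c / t) ^+ 2 * (h * Q) * E = ((c / t) ^+ 2 * h * Q) * ((1 + k) * E) by ring.
  apply: ler_pM => //; first by rewrite mulr_ge0// ltW.
    exact: ltW.
  by rewrite ler_wpM2l.
split; first exact: le_trans WG.
apply: le_trans HW _; rewrite -/h.
by apply: ler_pM => //; exact: ltW.
Qed.

End flow_length.

(** * The length distance as a real number on pairs at finite distance *)

Section length_dist_fin_lemmas.
Context (R : realType) (X : metricType R).
Implicit Types (x y z : X) (c : R).
Local Notation ld := (@length_dist_fin R X).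

Lemma length_dist_ge0 x y : (0 <= length_dist x y)%E.
Proof.
apply: le_ereal_inf_tmp => _ [g _ <-].
by apply: integral_ge0 => t _; rewrite lee_fin metric_derivative_ge0.
Qed.

Lemma length_dist_ltyP x y :
  (length_dist x y < +oo)%E <-> exists2 c, 0 <= c & lip_path c x y.
Proof.
split=> [xy|[c c0 /(lip_path_length c0) xyc]]; last by apply: le_lt_trans xyc _; rewrite ltry.
have fin : length_dist x y \is a fin_num by rewrite ge0_fin_numE// length_dist_ge0.
have : (length_dist x y < (ld x y + 1)%:E)%E.
  by rewrite -[X in (X < _)%E](fineK fin) lte_fin ltrDl.
by move=> /length_lip_path[c0 cxy]; exists (ld x y + 1).
Qed.

Lemma length_dist_finK x y : (length_dist x y < +oo)%E -> length_dist x y = (ld x y)%:E.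
Proof. by move=> xy; rewrite fineK// ge0_fin_numE// length_dist_ge0. Qed.

Lemma length_dist_fin_ge0 x y : 0 <= ld x y.
Proof. by apply: fine_ge0; exact: length_dist_ge0. Qed.

Lemma length_dist_fin_le c x y : 0 <= c -> lip_path c x y -> ld x y <= c.
Proof.
move=> c0 cxy; have xyc := lip_path_length c0 cxy.
by rewrite -lee_fin -length_dist_finK//; apply: le_lt_trans xyc _; rewrite ltry.
Qed.

Lemma length_dist_fin_lt c x y : (length_dist x y < +oo)%E -> ld x y < c -> lip_path c x y.
Proof.
by move=> xy xyc; apply: (length_lip_path _).2; rewrite length_dist_finK// lte_fin.
Qed.

Lemma length_dist_fin_xx x : ld x x = 0.
Proof.
apply/eqP; rewrite eq_le length_dist_fin_ge0 andbT.
by apply: length_dist_fin_le => //; exact: lip_path_refl.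
Qed.

Lemma length_dist_fin_sym x y : (length_dist x y < +oo)%E -> ld y x <= ld x y.
Proof.
move=> xy; apply/ler_addgt0Pr => e e0; apply: length_dist_fin_le.
  by rewrite addr_ge0 ?length_dist_fin_ge0// ltW.
by apply/lip_path_sym/length_dist_fin_lt => //; rewrite ltrDl.
Qed.

Lemma length_dist_fin_triangle x y z : (length_dist x y < +oo)%E ->
  (length_dist y z < +oo)%E -> ld x z <= ld x y + ld y z.
Proof.
move=> xy yz; apply/ler_addgt0Pr => e e0.
have := length_dist_fin_ge0 x y; have := length_dist_fin_ge0 y z => ? ?.
have -> : ld x y + ld y z + e = (ld x y + e / 2) + (ld y z + e / 2) by field.
apply: length_dist_fin_le; first lra.
by apply: (lip_path_cat (y := y)); [lra|lra|apply: length_dist_fin_lt => //; lra..].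
Qed.

Lemma mdist_le_length_dist x y : (length_dist x y < +oo)%E -> mdist x y <= ld x y.
Proof.
move=> xy; apply/ler_addgt0Pr => e e0; apply: mdist_lip_path.
  by rewrite addr_ge0 ?length_dist_fin_ge0// ltW.
by apply: length_dist_fin_lt => //; rewrite ltrDl.
Qed.

End length_dist_fin_lemmas.

(** * Approximate convexity for the length distance *)

Section flow_length_convexity.
Context (R : realType) (X : metricType R) (phi : X -> \bar R) (lambda : R).
Context (D : set X) (S : R -> X -> X).
Hypothesis phi_gtNy : forall x, (-oo < phi x)%E.
Hypothesis phi_lsc : lower_semicontinuous phi.
Hypothesis S_flow : EVI_flow phi lambda D S.
Hypothesis DT : forall x, D x.

Local Notation f x := (fine (phi x)).
Local Notation ld := (@length_dist_fin R X).

(** The limit [k -> 0] of [flow_lip_path]. It plays the role of [EVI_flow_sq], with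
    [1 - lambda t + 8 lambda^2 t^2] and [t] as coefficients. *)
Lemma flow_length_sq x v (c t : R) : 0 < t -> 2 * `|lambda| * t <= 2^-1 ->
  0 <= c -> lip_path c v x -> Dom phi v ->
  (length_dist v (S t x) < +oo)%E /\
  ld v (S t x) ^+ 2 <= (1 - lambda * t + 8 * lambda ^+ 2 * t ^+ 2) * c ^+ 2
                       + 2 * t * (f v - f (S t x)).
Proof.
move=> t0 lt c0 cvx dv.
pose L (k : R) := (1 + k) * ((1 + k) * c ^+ 2 * (1 + k + 8 * lambda ^+ 2 * t ^+ 2 - lambda * t)
             + 2 * t * (f v - f (S t x))).
have LP (k : R) : 0 < k ->
    0 <= L k /\ forall mu, 0 < mu -> L k <= mu ^+ 2 -> lip_path mu v (S t x).
  by move=> k0; exact: (flow_lip_path phi_gtNy phi_lsc S_flow DT t0 lt c0 cvx dv k0).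
have ldL (k : R) : 0 < k -> ld v (S t x) ^+ 2 <= L k.
  move=> /LP[L0 Lmu]; rewrite -(sqr_sqrtr L0) lerXn2r ?nnegrE ?sqrtr_ge0 ?length_dist_fin_ge0//.
  apply/ler_addgt0Pr => e e0; have s0 := sqrtr_ge0 (L k).
  apply: length_dist_fin_le; first lra.
  apply: Lmu; first lra.
  by rewrite -{1}(sqr_sqrtr L0) lerXn2r ?nnegrE//; lra.
have lim : L k @[k --> 0^'+] --> L 0.
  apply: cvg_at_right_filter; apply: cvgM; first by apply: cvgD; [exact: cvg_cst|exact: cvg_id].
  apply: cvgD; last exact: cvg_cst.
  apply: cvgM.
    by apply: cvgM; [apply: cvgD; [exact: cvg_cst|exact: cvg_id]|exact: cvg_cst].
  apply: cvgB; last exact: cvg_cst.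
  apply: cvgD; last exact: cvg_cst.
  by apply: cvgD; [exact: cvg_cst|exact: cvg_id].
split.
  apply/length_dist_ltyP; have [L0 Lmu] := LP 1 ltr01.
  (* For finiteness any crude radius will do: [L <= (L + 1)^2] for [L >= 0]. *)
  exists (L 1 + 1); first by rewrite addr_ge0.
  apply: Lmu; first by rewrite ltr_wpDl.
  have -> : (L 1 + 1) ^+ 2 = L 1 ^+ 2 + 2 * L 1 + 1 by ring.
  have := sqr_ge0 (L 1); lra.
have -> : (1 - lambda * t + 8 * lambda ^+ 2 * t ^+ 2) * c ^+ 2 + 2 * t * (f v - f (S t x)) = L 0.
  by rewrite /L; ring.
apply: cvgr_to_ge lim _; near=> k; apply: ldL; near: k; exact: nbhs_right_gt.
Unshelve. all: by end_near. Qed.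

Lemma approx_convex_length_class z : approx_convex ld phi lambda (length_class z).
Proof.
move=> x0 x1 [zx0 d0] [zx1 d1] theta eps th /andP[eps0 _].
have [c00 c000 p0] := (length_dist_ltyP _ _).1 zx0.
have [c11 c110 p1] := (length_dist_ltyP _ _).1 zx1.
have fin01 : (length_dist x0 x1 < +oo)%E.
  apply/length_dist_ltyP; exists (c00 + c11); first exact: addr_ge0.
  by apply: (lip_path_cat (y := z)) => //; exact: lip_path_sym.
have [c0|c0] := eqVneq (ld x0 x1) 0.
  have x01 : x0 = x1.
    apply: mdist_positivity; apply/eqP; rewrite eq_le mdist_ge0 andbT -c0.
    exact: mdist_le_length_dist.
  rewrite -x01; exists x0; split => //.
    exact/intermediate_id/length_dist_fin_xx.
  rewrite (convex_comb_fine phi_gtNy)// {1}(Dom_fine phi_gtNy d0) lee_fin length_dist_fin_xx.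
  by rewrite expr0n/= mulr0; lra.
have c_gt0 : 0 < ld x0 x1 by rewrite lt_neqAle eq_sym c0 length_dist_fin_ge0.
set c := ld x0 x1 in c_gt0 *.
have c2 : 0 <= 2 * c by lra.
have [t1 t10 [K t1K]] := flow_lower_bound_near phi_gtNy phi_lsc S_flow (DT x0) d0 c2.
pose A t := 1 - lambda * t + 8 * lambda ^+ 2 * t ^+ 2.
have Nl1 : lambda <= `|lambda| by exact: ler_norm.
have Nl2 : - lambda <= `|lambda| by rewrite -normrN ler_norm.
have AB (eta : R) : 0 < eta -> exists2 t0, 0 < t0 & forall t, 0 < t -> t < t0 ->
    [/\ 0 <= A t, A t <= 1 + eta, 0 < t, t <= eta & (lambda - eta) * t <= 1 - A t].
  move=> eta0.
  pose C := `|lambda| + 8 * lambda ^+ 2 + 1.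
  have l2 : 0 <= lambda ^+ 2 by exact: sqr_ge0.
  have C1 : 1 <= C by rewrite /C; have := normr_ge0 lambda; lra.
  have C0 : 0 < C by lra.
  exists (Num.min 1 (Num.min eta 1 / C)).
    by rewrite lt_min ltr01 divr_gt0// lt_min eta0 ltr01.
  move=> t t0; rewrite lt_min ltr_pdivlMr// lt_min => /and3P[t_lt1 tCe tC1].
  have tC : t * C = t * `|lambda| + t * (8 * lambda ^+ 2) + t by rewrite /C; ring.
  have n0 : 0 <= t * `|lambda| by rewrite mulr_ge0// ltW.
  have n1 : 0 <= t * (8 * lambda ^+ 2) by apply: mulr_ge0; lra.
  have q0 : 0 <= 8 * lambda ^+ 2 * t ^+ 2.
    by apply: mulr_ge0; [lra|exact: sqr_ge0].
  have q1 : 8 * lambda ^+ 2 * t ^+ 2 <= t * (8 * lambda ^+ 2).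
    have -> : 8 * lambda ^+ 2 * t ^+ 2 = t * (8 * lambda ^+ 2) * t by ring.
    by apply: ler_piMr => //; exact: ltW.
  have q2 : 8 * lambda ^+ 2 * t ^+ 2 <= eta * t.
    have -> : 8 * lambda ^+ 2 * t ^+ 2 = t * (8 * lambda ^+ 2) * t by ring.
    by rewrite ler_pM2r//; lra.
  have l1 : lambda * t <= t * `|lambda| by rewrite mulrC ler_pM2l.
  have l3 : - (lambda * t) <= t * `|lambda| by rewrite -mulNr mulrC ler_pM2l.
  by rewrite /A; split; lra.
(* The second bound gives the smallness [2 * |lambda| * t <= 1 / 2] required by [flow_length_sq]. *)
pose t2 := Num.min t1 (4 * `|lambda| + 1)^-1.
have l40 : 0 < 4 * `|lambda| + 1 by have := normr_ge0 lambda; lra.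
have t20 : 0 < t2 by rewrite lt_min t10 invr_gt0.
have [t [de [t_gt0 tt2 de0 main]]] := @approx_convex_params R lambda theta eps c (f x0) (f x1) K t2
  A id th eps0 c_gt0 t20 AB.
have [tt1 tl] : t < t1 /\ 2 * `|lambda| * t <= 2^-1.
  move: tt2; rewrite lt_min => /andP[-> tl]; split => //.
  have : t * (4 * `|lambda| + 1) < 1 by rewrite -ltr_pdivlMr ?div1r.
  lra.
have [th0 th1'] := andP th; have th1 : 0 < 1 - theta by lra.
(* The infimum of lengths may not be attained, so a path of length [c * (1 + e)] is cut in the ratio
   [theta]; the constant 3 comes from [(1 + e)^2 <= 1 + 3 e]. *)
pose e := Num.min 1 (de / 3).
have e0 : 0 < e by rewrite lt_min ltr01 divr_gt0.
have e1 : e <= 1 by rewrite /e ge_min lexx.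
have ede : e <= de / 3 by rewrite /e ge_min lexx orbT.
pose c' := c * (1 + e).
have cc' : c < c' by rewrite /c' ltr_pMr//; lra.
have c'_le : c' <= 2 * c by rewrite /c' mulrC ler_pM2r//; lra.
have r00 : 0 <= theta * c' by apply: mulr_ge0; lra.
have r10 : 0 <= (1 - theta) * c' by apply: mulr_ge0; lra.
have [x [x0x xx1]] : exists x, lip_path (theta * c') x0 x /\ lip_path ((1 - theta) * c') x x1.
  apply: lip_path_cut => //.
  have -> : theta * c' + (1 - theta) * c' = c' by ring.
  exact: length_dist_fin_lt.
have dy := EVI_flow_Dom S_flow (DT x) t_gt0.
have [fin0 sq0] := flow_length_sq t_gt0 tl r00 x0x d0.
have [fin1 sq1] := flow_length_sq t_gt0 tl r10 (lip_path_sym xx1) d1.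
have fin1' : (length_dist (S t x) x1 < +oo)%E.
  have [r r0 rp] := (length_dist_ltyP _ _).1 fin1.
  by apply/length_dist_ltyP; exists r => //; exact: lip_path_sym.
have sym1 : ld (S t x) x1 = ld x1 (S t x).
  by apply/le_anti; rewrite !length_dist_fin_sym.
have [|||||int fy] := main (ld x0 (S t x)) (ld x1 (S t x))
  (theta * c') ((1 - theta) * c') (f (S t x)).
- by rewrite -sym1; exact: length_dist_fin_triangle.
- exact: sq0.
- exact: sq1.
- have -> : (1 - theta) * (theta * c') ^+ 2 + theta * ((1 - theta) * c') ^+ 2 =
    theta * (1 - theta) * c ^+ 2 * (1 + e) ^+ 2 by rewrite /c'; ring.
  rewrite ler_pM2l; last by rewrite !mulr_gt0.
  have : e * e <= e by apply: ler_piMr => //; exact: ltW.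
  have -> : (1 + e) ^+ 2 = 1 + 2 * e + e * e by ring.
  lra.
- apply: t1K => //; apply: le_trans (mdist_lip_path r00 x0x) _; apply: le_trans c'_le.
  by apply: ler_piMl; lra.
exists (S t x); split.
- have [r r0 rp] := (length_dist_ltyP _ _).1 fin0.
  apply/length_dist_ltyP; exists (c00 + r); first exact: addr_ge0.
  exact: (lip_path_cat (y := x0)).
- by rewrite /intermediate sym1.
- by rewrite (convex_comb_fine phi_gtNy)// {1}(Dom_fine phi_gtNy dy) lee_fin.
Qed.

End flow_length_convexity.

Theorem theorem3p10 (R : realType) (X : metricType R) (phi : X -> \bar R)
    (phi_gtNy : forall x, (-oo < phi x)%E)
    (phi_proper : exists x, Dom phi x)
    (phi_lsc : lower_semicontinuous phi)
    (lambda : R) (D : set X) (D_sub : D `<=` closure (Dom phi))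
    (S : R -> X -> X) (S_flow : EVI_flow phi lambda D S) :
  (forall x0 x1, (D `&` Dom phi) x0 -> (D `&` Dom phi) x1 ->
   forall theta eps : R, 0 < theta < 1 -> 0 < eps < 1 ->
   forall x, D x -> intermediate mdist theta eps x0 x1 x ->
   forall t : R, 0 < t ->
     (phi (S t x) <= (1 - theta)%:E * phi x0 + theta%:E * phi x1
       - (2^-1 * (lambda - eps ^+ 2 / Elambda lambda t)
          * theta * (1 - theta) * mdist x0 x1 ^+ 2)%:E)%E)
  /\
  (approx_length_subset mdist D -> approx_convex mdist phi lambda D)
  /\
  (D = [set: X] -> length_closure (Dom phi) = [set: X] ->
   forall z : X, approx_convex (@length_dist_fin R X) phi lambda (length_class z))
  /\
  (forall x0 x1, (D `&` Dom phi) x0 -> (D `&` Dom phi) x1 ->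
   forall x, Geo D x0 x1 x -> convex_along phi lambda x0 x1 x)
  /\
  ((forall x0 x1, (D `&` Dom phi) x0 -> (D `&` Dom phi) x1 ->
     Geo D x0 x1 !=set0) ->
   strongly_convex phi lambda D).
Proof.
split; last split; last split; last split.
- move=> x0 x1 [D0 d0] [D1 d1] theta eps th _ x Dx int t t0.
  rewrite (convex_comb_fine phi_gtNy)//.
  rewrite {1}(Dom_fine phi_gtNy (EVI_flow_Dom S_flow Dx t0)) lee_fin.
  exact: (flow_potential_bound phi_gtNy phi_lsc S_flow).
- exact: approx_convex_length_subset phi_gtNy phi_lsc S_flow.
- move=> DT _ z.
  by apply: (approx_convex_length_class phi_gtNy phi_lsc S_flow) => x; rewrite DT.
- move=> x0 x1 [D0 d0] [D1 d1] x.
  exact: (convex_along_Geo phi_gtNy phi_lsc S_flow).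
- move=> geo x0 x1 h0 h1; split; first exact: geo.
  move=> x; case: h0 h1 => [D0 d0] [D1 d1].
  exact: (convex_along_Geo phi_gtNy phi_lsc S_flow).
Qed.
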